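(* Let $\mathcal X$ be a measurable space with a probability measure $\mu$, let $\lambda\in[0,1)$ and $\theta>0$. Let $F$ be a measurable map from $\mathcal X$ to real symmetric $d\times d$ matrices with $aI\preceq F(x)\preceq bI$ for all $x\in\mathcal X$. Let $T(x)=\frac12\left(F(x)\otimes I_d+I_d\otimes F(x)\right)$ and let $E_T^{\theta/2}$ be the operator on $L^2(\mu;\mathbb C^{d^2})$ given by $(E_T^{\theta/2}\mathbf h)(x)=\exp\left(\frac{\theta}{2}T(x)\right)\mathbf h(x)$. Let $s_1,\dots,s_n$ be the stationary Markov chain ($s_1\sim\mu$) that at each step stays at the current state with probability $\lambda$ and otherwise, with probability $1-\lambda$, moves to an independent sample from $\mu$, and let $\hat P=\lambda I+(1-\lambda)\tilde\Pi$ be its transition operator lifted to $L^2(\mu;\mathbb C^{d^2})$. Then $$\lim_{n\to\infty}\frac1n\log\mathbb E_\mu\left[\left\|\prod_{j=1}^n\exp\left(\tfrac{\theta}{2}F(s_j)\right)\right\|_F^2\right]=\log\left\|E_T^{\theta/2}\hat PE_T^{\theta/2}\right\|_\mu.$$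
   Context: $L^2(\mu;\mathbb C^{d^2})$ is the Hilbert space of measurable $\mathbf h:\mathcal X\to\mathbb C^{d^2}$ with $\mathbb E_\mu\|\mathbf h(x)\|^2<\infty$, inner product $\langle\mathbf f,\mathbf g\rangle_\mu=\int\langle\mathbf f(x),\mathbf g(x)\rangle\,d\mu(x)$ (standard Euclidean inner product on $\mathbb C^{d^2}$); $\|\cdot\|_\mu$ denotes the corresponding norm and the induced operator norm. $\tilde\Pi$ is the orthogonal projection onto constant functions, $(\tilde\Pi\mathbf h)(x)=\mathbb E_\mu[\mathbf h]$. $\otimes$ between matrices is the Kronecker product. $\prod_{j=1}^nA_j=A_1\cdots A_n$ (ordered product); $\|\cdot\|_F$ is the Frobenius norm; $\mathbb E_\mu$ of chain quantities means $s_1\sim\mu$. *)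

(* Defs.v *)
From HB Require Import structures.
From mathcomp Require Import all_boot all_order all_algebra.
From mathcomp Require Import all_classical all_reals all_analysis.
From mathcomp Require Export mxtens complex.

Set Implicit Arguments.
Unset Strict Implicit.
Unset Printing Implicit Defensive.

Import Order.TTheory GRing.Theory Num.Theory.
Import numFieldNormedType.Exports.

Local Open Scope classical_set_scope.
Local Open Scope ring_scope.

(** Matrices *)

(* Sum of the power series in the normed module of d x d matrices. *)
Definition expmx {R : realType} {d : nat} (A : 'M[R]_d) : 'M[R]_d :=
  limn (series (fun k : nat => (k`!%:R : R)^-1 *: A ^+ k)).

Definition frobenius {R : realType} {m n : nat} (A : 'M[R]_(m, n)) : R :=
  Num.sqrt (\sum_i \sum_j `|A i j| ^+ 2).

Definition psdmx {R : realType} {d : nat} (A : 'M[R]_d) : Prop :=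
  forall v : 'cV[R]_d, 0 <= (v^T *m A *m v) 0 0.

Definition loewner_le {R : realType} {d : nat} (A B : 'M[R]_d) : Prop :=
  psdmx (B - A).

Definition measurable_mx {R : realType} {dX : measure_display}
    {X : measurableType dX} {m n : nat} (F : X -> 'M[R]_(m, n)) : Prop :=
  forall i j, measurable_fun setT (fun x => F x i j).

(** The space L^2(mu; C^m) *)

Definition dotc {R : realType} {m : nat} (u v : 'cV[R[i]]_m) : R[i] :=
  \sum_i (u i 0)^* * v i 0.

(* [dotc u u] is a nonnegative real, so taking its real part loses nothing. *)
Definition cnorm {R : realType} {m : nat} (u : 'cV[R[i]]_m) : R :=
  Num.sqrt (complex.Re (dotc u u)).

(* Borel measurability on C^m: all real and imaginary parts are measurable. *)
Definition measurable_cvec {R : realType} {dX : measure_display}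
    {X : measurableType dX} {m : nat} (h : X -> 'cV[R[i]]_m) : Prop :=
  forall i, measurable_fun setT (fun x => complex.Re (h x i 0)) /\
            measurable_fun setT (fun x => complex.Im (h x i 0)).

Section L2.
Context {R : realType} {dX : measure_display} {X : measurableType dX}.
Variable mu : probability X R.

(* The norm (int <h, h> dmu)^(1/2) attached to the inner product of L^2; it is
   extended-real valued, and +oo when [h] is not square integrable. *)
Definition L2norm {m : nat} (h : X -> 'cV[R[i]]_m) : \bar R :=
  'N[mu]_2%:E[EFin \o (fun x => cnorm (h x))].

(* Elements of L^2 are represented by functions, and operators on L^2 by maps
   on functions; the norms below do not distinguish almost everywhere equal
   representatives. *)
Definition inL2 {m : nat} (h : X -> 'cV[R[i]]_m) : Prop :=
  measurable_cvec h /\ (L2norm h < +oo)%E.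

Definition L2opnorm {m : nat}
    (A : (X -> 'cV[R[i]]_m) -> (X -> 'cV[R[i]]_m)) : \bar R :=
  ereal_sup [set L2norm (A h) | h in [set h | inL2 h /\ (L2norm h <= 1)%E]].

Definition cvec_mean {m : nat} (h : X -> 'cV[R[i]]_m) : 'cV[R[i]]_m :=
  \col_i Complex (\int[mu]_x complex.Re (h x i 0))
                 (\int[mu]_x complex.Im (h x i 0)).

Definition Pi_tilde {m : nat} (h : X -> 'cV[R[i]]_m) : X -> 'cV[R[i]]_m :=
  fun=> cvec_mean h.

Definition P_hat {m : nat} (lambda : R) (h : X -> 'cV[R[i]]_m) :
    X -> 'cV[R[i]]_m :=
  fun x => real_complex R lambda *: h x
           + real_complex R (1 - lambda) *: Pi_tilde h x.

End L2.

Definition kron_half {R : realType} {dX : measure_display}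
    {X : measurableType dX} {d : nat} (F : X -> 'M[R]_d) (x : X) :
    'M[R]_(d * d) :=
  2^-1 *: (tensmx (F x) 1%:M + tensmx 1%:M (F x)).

(* [expmul T t] is the operator h |-> exp (t T(.)) h(.). *)
Definition expmul {R : realType} {dX : measure_display}
    {X : measurableType dX} {m : nat} (T : X -> 'M[R]_m) (t : R)
    (h : X -> 'cV[R[i]]_m) : X -> 'cV[R[i]]_m :=
  fun x => map_mx (real_complex R) (expmx (t *: T x)) *m h x.

(** Markov chains *)

(* The sigma-algebra on the sample space generated by s_0, ..., s_n. *)
Definition past {dX dO : measure_display} {X : measurableType dX}
    {Omega : measurableType dO} (s : nat -> Omega -> X) (n : nat) :
    set (set Omega) :=
  <<s \bigcup_(i in `I_n.+1) preimage_set_system setT (s i) measurable >>.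

(* [s] is a Markov chain under [Pr] with initial law [mu] and transition
   kernel [K]: P(s_{n+1} in A | s_0, ..., s_n) = K(s_n, A) almost surely, the
   conditional probability being spelled out by its defining property. *)
Record markov_chain {R : realType} {dX dO : measure_display}
    {X : measurableType dX} {Omega : measurableType dO}
    (mu : probability X R) (K : X -> set X -> \bar R)
    (Pr : probability Omega R) (s : nat -> Omega -> X) : Prop := {
  chain_measurable : forall n, measurable_fun setT (s n) ;
  chain_initial : forall A, measurable A -> Pr (s 0%N @^-1` A) = mu A ;
  chain_step : forall n A B, measurable A -> past s n B ->
    Pr (B `&` s n.+1 @^-1` A) = (\int[Pr]_(w in B) K (s n w) A)%E }.

(* Stay put with probability [lambda], otherwise draw afresh from [mu]. *)
Definition lazy_kernel {R : realType} {dX : measure_display}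
    {X : measurableType dX} (mu : probability X R) (lambda : R)
    (x : X) (A : set X) : \bar R :=
  (lambda%:E * \d_x A + (1 - lambda)%:E * mu A)%E.

(* Main.v *)
Require Import Defs.
From HB Require Import structures.
From mathcomp Require Import all_boot all_order all_algebra.
From mathcomp Require Import all_classical all_reals all_analysis.
From mathcomp Require Import measurable_realfun.
From mathcomp Require Import ring lra.

(** Write [B = exp (theta/2 T) = G (x) G] with [G = exp (theta/4 F)], let [A] be
    the operator [f |-> B (P (B f))], and let [g = B vec(I)]. Vectorising the
    matrix product and conditioning along the chain gives
    [E |prod_{j <= n} exp (theta/2 F (s_j))|_F^2 = <g, A^n g>], which is at most
    [|A|^n |g|^2].

    For the lower bound, view elements of [L^2] as functions with values in
    d x d matrices. Both [M |-> G M G] and averaging preserve the positive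
    semidefinite cone, and [g = exp (theta/2 F)] is uniformly interior to it;
    hence [|<f, A^n h>| <= C <g, A^n g>] for all bounded [f] and [h]. If
    [|A f| > r |f|] for a bounded [f], log-convexity of [n |-> |A^n f|^2]
    makes the left-hand side, and therefore [<g, A^n g>], grow at least like
    [r^n]. Bounded functions compute the norm of [A], by truncation. *)

Set Implicit Arguments.
Unset Strict Implicit.
Unset Printing Implicit Defensive.

Import Order.TTheory GRing.Theory Num.Theory.
Import numFieldNormedType.Exports.

Local Open Scope classical_set_scope.
Local Open Scope ring_scope.

(** * Matrix exponentials of symmetric matrices *)

(** The obstacle is the lower bound. For a general self-adjoint [A], the numbers [<g, A^n g>] only
    see the part of the spectrum that [g] charges, and their growth rate may fall short of [|A|].
    Domination by [g] rules this out; its constants come from [a I <= F], which gives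
    [exp (theta/2 F) >= c I] with [c = exp (theta a / 2)]. Log-convexity, that is, Cauchy-Schwarz
    for a self-adjoint operator, then stands in for the spectral theorem on [L^2].

    The exponent [theta/4] is due to the factor [1/2] in [T]. Each factor of the vectorised product
    is thus [B B]; one [B] at either end is absorbed in [g], so that [n + 1] factors leave the power
    [A^n].

    As [B] is real, the complex operator acts separately on real and imaginary parts. The estimates
    are therefore made for bounded real functions, where every product is integrable, and complex
    functions return only with the operator norm. *)

Lemma Re_sum (R : realType) (I : Type) (r : seq I) (P : pred I) (f : I -> R[i]) :
  complex.Re (\sum_(i <- r | P i) f i) = \sum_(i <- r | P i) complex.Re (f i).
Proof. by apply: (big_morph (@complex.Re R)) => // -[? ?] [? ?]. Qed.

Lemma Im_sum (R : realType) (I : Type) (r : seq I) (P : pred I) (f : I -> R[i]) :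
  complex.Im (\sum_(i <- r | P i) f i) = \sum_(i <- r | P i) complex.Im (f i).
Proof. by apply: (big_morph (@complex.Im R)) => // -[? ?] [? ?]. Qed.

Lemma Re_scale (R : realType) (r : R) (z : R[i]) :
  complex.Re (real_complex R r * z) = r * complex.Re z.
Proof. by case: z => x y /=; rewrite mul0r subr0. Qed.

Lemma Im_scale (R : realType) (r : R) (z : R[i]) :
  complex.Im (real_complex R r * z) = r * complex.Im z.
Proof. by case: z => x y /=; rewrite mul0r addr0. Qed.

Lemma Re_mulJ (R : realType) (z w : R[i]) :
  complex.Re (z * w^*) = complex.Re z * complex.Re w + complex.Im z * complex.Im w.
Proof. by case: z w => [x y] [x' y'] /=; rewrite mulrN opprK. Qed.

Lemma hermitian_diagonalization (C : numClosedFieldType) (n : nat) (A : 'M[C]_n) :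
  A \is hermsymmx ->
  exists (Q : 'M[C]_n) (D : 'rV[C]_n), [/\ D \is a mxOver Num.real,
    A *m Q = Q *m diag_mx D, Q *m map_mx Num.conj Q^T = 1%:M &
    map_mx Num.conj Q^T *m Q = 1%:M].
Proof.
move=> Ah; have Pu := spectral_unitarymx A; have Pi := spectral_unit A.
have /hermitian_normalmx/orthomx_spectralP AE := Ah.
exists (invmx (spectralmx A)), (spectral_diag A).
have -> : map_mx Num.conj (invmx (spectralmx A))^T = spectralmx A.
  by rewrite invmx_unitary // trmxCK.
split; [exact: hermitian_spectral_diag_real| |exact: mulVmx|exact: mulmxV].
by rewrite {1}AE mulmxK.
Qed.

(** Column [k] of a complex unitary diagonalisation is [U k + i W k]. Since [F] and the eigenvalues
    are real, both parts are eigenvectors, and [U U^T + W W^T] is the real part of the rank-one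
    projection onto that column. This avoids choosing a real orthonormal basis. *)
Lemma real_spectral (R : realType) (d : nat) (F : 'M[R]_d) : F^T = F ->
  exists (D : 'I_d -> R) (U W : 'I_d -> 'cV[R]_d),
    [/\ forall k, F *m U k = D k *: U k, forall k, F *m W k = D k *: W k,
        \sum_k (U k *m (U k)^T + W k *m (W k)^T) = 1%:M &
        forall k, ((U k)^T *m U k) 0 0 + ((W k)^T *m W k) 0 0 = 1].
Proof.
move=> Fs; pose Fc := map_mx (real_complex R) F.
have Fh : Fc \is hermsymmx.
  apply: realsym_hermsym.
    by apply/is_hermitianmxP; rewrite expr0 scale1r map_mx_id // map_trmx Fs.
  by apply/mxOverP => i j; rewrite mxE complex_real.
have [Q [D [Dr FQ QQ PQ]]] := hermitian_diagonalization Fh.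
have DE k : D 0 k = real_complex R (complex.Re (D 0 k)).
  by rewrite RRe_real //; move/mxOverP: Dr; apply.
have FQE i k : \sum_j real_complex R (F i j) * Q j k =
    real_complex R (complex.Re (D 0 k)) * Q i k.
  have /matrixP/(_ i k) := FQ; rewrite mul_mx_diag !mxE => E.
  rewrite -DE [RHS]mulrC -E; apply: eq_bigr => j _; by rewrite mxE.
exists (fun k => complex.Re (D 0 k)), (fun k => \col_i complex.Re (Q i k)),
  (fun k => \col_i complex.Im (Q i k)); split.
- move=> k; apply/colP => i; rewrite !mxE -Re_scale -FQE Re_sum.
  by apply: eq_bigr => j _; rewrite mxE Re_scale.
- move=> k; apply/colP => i; rewrite !mxE -Im_scale -FQE Im_sum.
  by apply: eq_bigr => j _; rewrite mxE Im_scale.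
- apply/matrixP => i j; rewrite summxE.
  have /matrixP/(_ i j)/(congr1 (@complex.Re R)) := QQ.
  rewrite !mxE Re_sum => E.
  transitivity (complex.Re ((i == j)%:R : R[i])); last by case: (i == j).
  rewrite -E; apply: eq_bigr => k _.
  by rewrite !mxE !big_ord1 !mxE; exact/esym/Re_mulJ.
- move=> k; have /matrixP/(_ k k)/(congr1 (@complex.Re R)) := PQ.
  rewrite !mxE eqxx Re_sum /= => <-; rewrite -big_split; apply: eq_bigr => i _.
  by rewrite !mxE [X in _ = complex.Re X]mulrC; exact/esym/Re_mulJ.
Qed.

Lemma cvg_sum_seq (R : realType) (V : normedModType R) (I : Type) (r : seq I)
    (u : I -> nat -> V) (l : I -> V) :
  (forall i, u i n @[n --> \oo] --> l i) ->
  (\sum_(i <- r) u i n) @[n --> \oo] --> \sum_(i <- r) l i.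
Proof.
move=> ul; elim: r => [|i r IH].
  rewrite big_nil; under eq_fun do rewrite big_nil; exact: cvg_cst.
rewrite big_cons; under eq_fun do rewrite big_cons.
exact: cvgD (ul i) IH.
Qed.

Section Resolution.
Variables (R : realType) (n : nat) (I : finType).
Variables (X : 'M[R]_n) (D : I -> R) (E : I -> 'M[R]_n).
Hypothesis XE : forall i, X *m E i = D i *: E i.
Hypothesis E1 : \sum_i E i = 1%:M.

(** The columns of [E i] are eigenvectors, but [E i] may fail to be a projection, as happens for the
    real parts produced by [real_spectral]. Expanding the identity as [\sum_i E i] is all that the
    functional calculus uses. *)
Lemma expr_resolution k : X ^+ k = \sum_i D i ^+ k *: E i.
Proof.
have XkE i : X ^+ k *m E i = D i ^+ k *: E i.
  elim: k => [|k IH]; first by rewrite expr0 mul1mx scale1r.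
  by rewrite exprS -mulmxA IH -scalemxAr XE scalerA exprSr.
rewrite -[LHS]mulmx1 -E1 mulmx_sumr; exact: eq_bigr.
Qed.

Lemma expmx_series_cvg :
  series (fun k => (k`!%:R : R)^-1 *: X ^+ k) @ \oo --> \sum_i expR (D i) *: E i.
Proof.
have -> : series (fun k => (k`!%:R : R)^-1 *: X ^+ k) =
    (fun n => \sum_i series (exp_coeff (D i)) n *: E i).
  apply/funext => m; rewrite /series /=.
  under eq_bigr do rewrite expr_resolution scaler_sumr.
  rewrite exchange_big; apply: eq_bigr => i _; rewrite scaler_suml.
  by apply: eq_bigr => k _; rewrite scalerA mulrC.
apply: (@cvg_sum_seq _ 'M[R]_n) => i.
apply: (@cvgZr_tmp _ 'M[R]_n); exact: is_cvg_series_exp_coeff.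
Qed.

Lemma expmx_resolution : expmx X = \sum_i expR (D i) *: E i.
Proof. by apply: cvg_lim expmx_series_cvg; exact: norm_hausdorff. Qed.

End Resolution.

Lemma expmx_entry_cvg (R : realType) (n : nat) (I : finType) (X : 'M[R]_n)
    (D : I -> R) (E : I -> 'M[R]_n) i j :
  (forall i, X *m E i = D i *: E i) -> \sum_i E i = 1%:M ->
  (series (fun k => (k`!%:R : R)^-1 *: X ^+ k) m) i j @[m --> \oo] -->
  expmx X i j.
Proof.
move=> XE E1; rewrite (expmx_resolution XE E1).
have H := expmx_series_cvg XE E1.
apply: (cvg_comp (fun m => series (fun k => (k`!%:R : R)^-1 *: X ^+ k) m)
  (fun M : 'M[R]_n => M i j) H).
exact: coord_continuous.
Qed.

(** Nothing is known about the products [E i *m E k], so [expmx_resolution] does not give this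
    directly. Instead every partial sum of the series acts on [E k] as a scalar, and the limit is
    taken entrywise. *)
Lemma expmx_eigen (R : realType) (n : nat) (I : finType) (X : 'M[R]_n)
    (D : I -> R) (E : I -> 'M[R]_n) :
  (forall i, X *m E i = D i *: E i) -> \sum_i E i = 1%:M ->
  forall i, expmx X *m E i = expR (D i) *: E i.
Proof.
move=> XE E1 k; apply/matrixP => i j; rewrite !mxE.
have c1 : \sum_l (series (fun k => (k`!%:R : R)^-1 *: X ^+ k) m) i l * E k l j
    @[m --> \oo] --> \sum_l expmx X i l * E k l j.
  apply: (@cvg_sum_seq _ R^o) => l.
  by apply: cvgMr_tmp; exact: expmx_entry_cvg XE E1.
have c2 : series (exp_coeff (D k)) m * E k i j
    @[m --> \oo] --> expR (D k) * E k i j.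
  by apply: cvgMr_tmp; exact: is_cvg_series_exp_coeff.
have XkE m : X ^+ m *m E k = D k ^+ m *: E k.
  elim: m => [|m IH]; first by rewrite expr0 mul1mx scale1r.
  by rewrite exprS -mulmxA IH -scalemxAr XE scalerA exprSr.
suff EQ m : \sum_l (series (fun k => (k`!%:R : R)^-1 *: X ^+ k) m) i l * E k l j
    = series (exp_coeff (D k)) m * E k i j.
  apply: (cvg_unique _ c1); first exact: norm_hausdorff.
  by rewrite (funext EQ).
transitivity ((series (fun k => (k`!%:R : R)^-1 *: X ^+ k) m *m E k) i j).
  by rewrite mxE.
rewrite /series /= mulmx_suml summxE mulr_suml; apply: eq_bigr => l _.
by rewrite -scalemxAl XkE scalerA mxE; congr (_ * _); exact: mulrC.
Qed.

Lemma sym_resolution (R : realType) (d : nat) (F : 'M[R]_d) (a b : R) :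
  F^T = F -> loewner_le a%:M F -> loewner_le F b%:M ->
  exists (D : 'I_d -> R) (E : 'I_d -> 'M[R]_d),
    [/\ forall k, F *m E k = D k *: E k, \sum_k E k = 1%:M,
        forall k, [/\ (E k)^T = E k, forall i j, `|E k i j| <= 1 &
          forall S, psdmx S -> 0 <= \tr (E k *m S)] &
        forall k, a <= D k <= b].
Proof.
move=> Fs aF Fb; have [D [U [W [FU FW UW1 n1]]]] := real_spectral Fs.
exists D, (fun k => U k *m (U k)^T + W k *m (W k)^T).
have quad (S : 'M[R]_d) (v : 'cV[R]_d) : \tr (v *m v^T *m S) = (v^T *m S *m v) 0 0.
  by rewrite -mulmxA mxtrace_mulC /mxtrace big_ord1.
split => //.
- by move=> k; rewrite mulmxDr !mulmxA FU FW -!scalemxAl -scalerDr.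
- move=> k; split.
  + by rewrite linearD /= !trmx_mul !trmxK.
  + move=> i j; rewrite !mxE !big_ord1 !mxE.
    have := n1 k; rewrite !mxE => n1k.
    have sq m : U k m 0 ^+ 2 + W k m 0 ^+ 2 <= 1.
      rewrite -n1k -big_split (bigD1 m) //= !mxE -!expr2 lerDl.
      by apply: sumr_ge0 => l _; rewrite !mxE -!expr2 addr_ge0 ?sqr_ge0.
    have := sq i; have := sq j.
    set x := U k i 0; set y := U k j 0; set z := W k i 0; set w := W k j 0.
    move=> h1 h2; rewrite ler_norml.
    (* [|x y + z w| <= (x^2 + z^2 + y^2 + w^2) / 2 <= 1]. *)
    have := sqr_ge0 (x - y); have := sqr_ge0 (x + y).
    have := sqr_ge0 (z - w); have := sqr_ge0 (z + w).
    by move=> *; apply/andP; split; nra.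
  + move=> S pS; rewrite mulmxDl mxtraceD !quad; apply: addr_ge0; exact: pS.
- move=> k; have E c v : F *m v = D k *: v ->
      (v^T *m (F - c%:M) *m v) 0 0 = (D k - c) * (v^T *m v) 0 0.
    move=> Fv; rewrite -mulmxA mulmxBl Fv mul_scalar_mx -scalerBl -scalemxAr.
    by rewrite mxE.
  have En c v : (v^T *m (c%:M - F) *m v) 0 0 = - (v^T *m (F - c%:M) *m v) 0 0.
    by rewrite -opprB mulmxN mulNmx mxE.
  (* [U k] or [W k] may vanish; only their squared norms together add up to [1], so the two
     quadratic forms are summed. *)
  apply/andP; split.
    have := addr_ge0 (aF (U k)) (aF (W k)).
    by rewrite !E // -mulrDr n1 mulr1 subr_ge0.
  have := addr_ge0 (Fb (U k)) (Fb (W k)).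
  by rewrite !En !E // -opprD -mulrDr n1 mulr1 opprB subr_ge0.
Qed.

Section ExpSym.
Variables (R : realType) (d : nat) (a b : R) (F : 'M[R]_d).
Hypotheses (Fs : F^T = F) (aF : loewner_le a%:M F) (Fb : loewner_le F b%:M).

Lemma expmx_sym_cvg (t : R) i j :
  (series (fun k => (k`!%:R : R)^-1 *: (t *: F) ^+ k) m) i j @[m --> \oo] -->
  expmx (t *: F) i j.
Proof.
have [D [E [FE E1 _ _]]] := sym_resolution Fs aF Fb.
apply: (@expmx_entry_cvg _ _ _ _ (fun k => t * D k) E) => // k.
by rewrite -scalemxAl FE scalerA.
Qed.

Lemma expmx_sym (t : R) : (expmx (t *: F))^T = expmx (t *: F).
Proof.
have [D [E [FE E1 Ep _]]] := sym_resolution Fs aF Fb.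
rewrite (@expmx_resolution _ _ _ _ (fun k => t * D k) E) //; last first.
  by move=> k; rewrite -scalemxAl FE scalerA.
rewrite linear_sum; apply: eq_bigr => k _ /=.
by rewrite linearZ /=; have [-> _ _] := Ep k.
Qed.

Lemma expmx_bound (t : R) i j : 0 <= t -> `|expmx (t *: F) i j| <= d%:R * expR (t * b).
Proof.
move=> t0; have [D [E [FE E1 Ep Db]]] := sym_resolution Fs aF Fb.
rewrite (@expmx_resolution _ _ _ _ (fun k => t * D k) E) //; last first.
  by move=> k; rewrite -scalemxAl FE scalerA.
rewrite summxE (le_trans (ler_norm_sum _ _ _)) //.
rewrite mulr_natl -[in leRHS](card_ord d) -sumr_const; apply: ler_sum => k _.
rewrite mxE normrM ger0_norm ?expR_ge0 //; have [_ Eb _] := Ep k.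
rewrite -[leRHS]mulr1 ler_pM ?expR_ge0 // ler_expR ler_wpM2l //.
by have /andP[] := Db k.
Qed.

(** The Loewner bound [exp (t F) >= e^(t a) I], in the form needed later: paired by the trace with a
    positive semidefinite [S]. *)
Lemma expmx_trace_ge (t : R) (S : 'M[R]_d) : 0 <= t -> psdmx S ->
  expR (t * a) * \tr S <= \tr (expmx (t *: F) *m S).
Proof.
move=> t0 pS; have [D [E [FE E1 Ep Db]]] := sym_resolution Fs aF Fb.
rewrite (@expmx_resolution _ _ _ _ (fun k => t * D k) E) //; last first.
  by move=> k; rewrite -scalemxAl FE scalerA.
rewrite -[in leLHS](mul1mx S) -E1 !mulmx_suml !linear_sum mulr_sumr.
apply: ler_sum => k _ /=; rewrite -scalemxAl linearZ /=.
have [_ _ trE] := Ep k; rewrite ler_wpM2r ?trE // ler_expR ler_wpM2l //.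
by have /andP[] := Db k.
Qed.

Lemma expmx_double (t : R) :
  expmx (t *: F) *m expmx (t *: F) = expmx ((t + t) *: F).
Proof.
have [D [E [FE E1 Ep Db]]] := sym_resolution Fs aF Fb.
have tFE s k : (s *: F) *m E k = (s * D k) *: E k.
  by rewrite -scalemxAl FE scalerA.
rewrite {2}(expmx_resolution (tFE t) E1) (expmx_resolution (tFE (t + t)) E1).
rewrite mulmx_sumr; apply: eq_bigr => k _.
by rewrite -scalemxAr (expmx_eigen (tFE t) E1) scalerA -expRD mulrDl.
Qed.

(** The matrices [E k (x) E l] resolve the identity for the averaged Kronecker sum, with eigenvalues
    [(D k + D l) / 2]; the scalar exponential splits, and so does the double sum. *)
Lemma expmx_kron (t : R) :
  expmx (t *: (2^-1 *: (tensmx F 1%:M + tensmx 1%:M F))) =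
  tensmx (expmx ((t / 2) *: F)) (expmx ((t / 2) *: F)).
Proof.
have [D [E [FE E1 Ep Db]]] := sym_resolution Fs aF Fb.
have tFE s k : (s *: F) *m E k = (s * D k) *: E k.
  by rewrite -scalemxAl FE scalerA.
pose E2 (kl : 'I_d * 'I_d) := tensmx (E kl.1) (E kl.2).
pose D2 (kl : 'I_d * 'I_d) := t / 2 * (D kl.1 + D kl.2).
have tE (I : finType) (x y : I -> R) (A B : I -> 'M[R]_d) :
    \sum_(kl : I * I) (x kl.1 * y kl.2) *: tensmx (A kl.1) (B kl.2) =
    tensmx (\sum_k x k *: A k) (\sum_l y l *: B l).
  apply/matrixP => i j; rewrite mxE !summxE.
  rewrite big_distrlr pair_bigA; apply: eq_bigr => -[k l] _ /=.
  by rewrite !mxE mulrACA.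
rewrite (@expmx_resolution _ _ _ _ D2 E2); first last.
- transitivity (tensmx (1%:M : 'M[R]_d) (1%:M : 'M[R]_d)).
    rewrite -E1; under [\sum_i E i]eq_bigr do rewrite -[E _]scale1r.
    rewrite -(tE _ (fun=> 1) (fun=> 1)); apply: eq_bigr => -[k l] _.
    by rewrite mulr1 scale1r.
  apply/matrixP => i j; rewrite !mxE -natrM mulnb.
  by congr (_ %:R); rewrite -xpair_eqE -!surjective_pairing (can_eq (@mxtens_unindexK _ _)).
- move=> -[k l]; rewrite /E2 /D2 /= -!scalemxAl mulmxDl !tensmx_mul !mul1mx !FE.
  rewrite scalerA; apply/matrixP => i j; rewrite !mxE; ring.
rewrite (expmx_resolution (tFE (t / 2)) E1) -tE.
apply: eq_bigr => -[k l] _; by rewrite /D2 /E2 /= mulrDr expRD.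
Qed.

End ExpSym.

Lemma measurable_expmx (R : realType) (dX : measure_display)
    (X : measurableType dX) (d : nat) (F : X -> 'M[R]_d) (a b t : R) :
  measurable_mx F -> (forall x, (F x)^T = F x) ->
  (forall x, loewner_le a%:M (F x) /\ loewner_le (F x) b%:M) ->
  measurable_mx (fun x => expmx (t *: F x)).
Proof.
move=> mF Fs Fb i j.
apply: (measurable_fun_cvg (h := fun m x =>
  (series (fun k => (k`!%:R : R)^-1 *: (t *: F x) ^+ k) m) i j)); last first.
  by move=> x _; have [aF bF] := Fb x; exact: (expmx_sym_cvg (Fs x) aF bF).
have mpow k : measurable_mx (fun x => (t *: F x) ^+ k).
  elim: k => [|k IH] i' j'; first exact: measurable_cst.
  under eq_fun do rewrite exprS mxE.
  apply: measurable_sum => l; apply: measurable_funM; last exact: IH.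
  by under eq_fun do rewrite mxE; exact: measurable_funM.
move=> m; rewrite /series /=.
under eq_fun do rewrite summxE.
apply: measurable_sum => k; under eq_fun do rewrite mxE.
by apply: measurable_funM; [exact: measurable_cst|exact: mpow].
Qed.

(** * Bounded measurable matrix functions *)

Section BoundedMatrixFunctions.
Context {R : realType} {dX : measure_display} {X : measurableType dX}.

(** This class is stable under products and its members are integrable, so means are linear and
    inner products finite without side conditions. *)
Definition bmeas_mx {m n : nat} (H : X -> 'M[R]_(m, n)) : Prop :=
  measurable_mx H /\ exists C, forall x i j, `|H x i j| <= C.

Lemma bmeas_mx_bound {m n} (H : X -> 'M[R]_(m, n)) : bmeas_mx H ->
  exists2 C, 0 <= C & forall x i j, `|H x i j| <= C.
Proof.
move=> [_ [C HC]]; exists `|C| => // x i j.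
exact: le_trans (HC x i j) (ler_norm _).
Qed.

Lemma bmeas_mx_cst {m n} (M : 'M[R]_(m, n)) : bmeas_mx (fun=> M).
Proof.
split; first by move=> i j; exact: measurable_cst.
exists (\sum_i \sum_j `|M i j|) => _ i j.
rewrite (bigD1 i) //= (bigD1 j) //= -addrA lerDl addr_ge0 //.
  exact: sumr_ge0.
by apply: sumr_ge0 => k _; exact: sumr_ge0.
Qed.

Lemma bmeas_mxD {m n} (H K : X -> 'M[R]_(m, n)) :
  bmeas_mx H -> bmeas_mx K -> bmeas_mx (fun x => H x + K x).
Proof.
move=> [mH [C HC]] [mK [C' KC']]; split.
  move=> i j; under eq_fun do rewrite mxE.
  exact: (measurable_funD (mH i j) (mK i j)).
exists (C + C') => x i j; rewrite mxE (le_trans (ler_normD _ _)) //.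
by rewrite lerD.
Qed.

Lemma bmeas_mxZ {m n} c (H : X -> 'M[R]_(m, n)) :
  bmeas_mx H -> bmeas_mx (fun x => c *: H x).
Proof.
move=> [mH [C HC]]; split.
  move=> i j; under eq_fun do rewrite mxE.
  by apply: (measurable_funM _ (mH i j)); exact: measurable_cst.
by exists (`|c| * C) => x i j; rewrite mxE normrM ler_wpM2l.
Qed.

Lemma bmeas_mxM {m n p} (H : X -> 'M[R]_(m, n)) (K : X -> 'M[R]_(n, p)) :
  bmeas_mx H -> bmeas_mx K -> bmeas_mx (fun x => H x *m K x).
Proof.
move=> bH bK; split.
  move=> i j; under eq_fun do rewrite mxE.
  apply: measurable_sum => k; exact: (measurable_funM (bH.1 i k) (bK.1 k j)).
have [C C0 HC] := bmeas_mx_bound bH; have [D D0 KD] := bmeas_mx_bound bK.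
exists (\sum_(k < n) C * D) => x i j; rewrite mxE (le_trans (ler_norm_sum _ _ _)) //.
by apply: ler_sum => k _; rewrite normrM ler_pM.
Qed.

Lemma bmeas_mx_tr {m n} (H : X -> 'M[R]_(m, n)) :
  bmeas_mx H -> bmeas_mx (fun x => (H x)^T).
Proof.
move=> [mH [C HC]]; split.
  by move=> i j; under eq_fun do rewrite mxE; exact: mH.
by exists C => x i j; rewrite mxE.
Qed.

Variable mu : probability X R.

Lemma bmeas_mx_integrable {m n} (H : X -> 'M[R]_(m, n)) i j : bmeas_mx H ->
  mu.-integrable setT (EFin \o (fun x => H x i j)).
Proof.
move=> [mH [C HC]]; apply: measurable_bounded_integrable => //.
  exact: le_lt_trans (probability_le1 mu measurableT) (ltry _).
by exists C; split=> [|M CM x _]; [exact: num_real|exact: le_trans (HC _ _ _) (ltW CM)].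
Qed.

Definition mean_mx {m n : nat} (H : X -> 'M[R]_(m, n)) : 'M[R]_(m, n) :=
  \matrix_(i, j) \int[mu]_x H x i j.

Lemma mean_mx_cst {m n} (M : 'M[R]_(m, n)) : mean_mx (fun=> M) = M.
Proof.
apply/matrixP => i j.
by rewrite mxE Rintegral_cst //= probability_setT /= mulr1.
Qed.

Lemma mean_mxD {m n} (H K : X -> 'M[R]_(m, n)) : bmeas_mx H -> bmeas_mx K ->
  mean_mx (fun x => H x + K x) = mean_mx H + mean_mx K.
Proof.
move=> bH bK; apply/matrixP => i j; rewrite !mxE.
rewrite -RintegralD ?bmeas_mx_integrable //.
by apply: eq_Rintegral => x _; rewrite mxE.
Qed.

Lemma mean_mxZ {m n} c (H : X -> 'M[R]_(m, n)) : bmeas_mx H ->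
  mean_mx (fun x => c *: H x) = c *: mean_mx H.
Proof.
move=> bH; apply/matrixP => i j; rewrite !mxE -RintegralZl ?bmeas_mx_integrable //.
by apply: eq_Rintegral => x _; rewrite mxE.
Qed.

Lemma mean_mx_tr {m n} (H : X -> 'M[R]_(m, n)) :
  mean_mx (fun x => (H x)^T) = (mean_mx H)^T.
Proof.
apply/matrixP => i j; rewrite !mxE.
by apply: eq_Rintegral => x _; rewrite mxE.
Qed.

Lemma mean_mx_sum {m n} (I : Type) (r : seq I) (H : I -> X -> 'M[R]_(m, n)) :
  (forall i, bmeas_mx (H i)) ->
  mean_mx (fun x => \sum_(i <- r) H i x) = \sum_(i <- r) mean_mx (H i) /\
  bmeas_mx (fun x => \sum_(i <- r) H i x).
Proof.
move=> bH; elim: r => [|i r [IH1 IH2]].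
  under eq_fun do rewrite big_nil.
  rewrite big_nil mean_mx_cst; split => //; exact: bmeas_mx_cst.
under eq_fun do rewrite big_cons.
rewrite big_cons mean_mxD // IH1; split => //; exact: bmeas_mxD.
Qed.

Lemma mean_mxM {m n p} (H : X -> 'M[R]_(m, n)) (K : X -> 'M[R]_(n, p)) i j :
  bmeas_mx H -> bmeas_mx K ->
  mean_mx (fun x => H x *m K x) i j = \sum_k \int[mu]_x (H x i k * K x k j).
Proof.
(* Each scalar product is viewed as a 1 x 1 matrix, so that [mean_mx_sum] exchanges sum and mean. *)
move=> bH bK; pose L k x : 'M[R]_1 := (H x i k * K x k j)%:M.
have bL k : bmeas_mx (L k).
  split=> [a b|].
    rewrite (ord1 a) (ord1 b) /L; under eq_fun do rewrite mxE eqxx mulr1n.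
    exact: (measurable_funM (bH.1 i k) (bK.1 k j)).
  have [M M0 HM] := bmeas_mx_bound bH; have [N N0 KN] := bmeas_mx_bound bK.
  by exists (M * N) => x a b; rewrite (ord1 a) (ord1 b) mxE eqxx mulr1n normrM ler_pM.
have [/matrixP/(_ 0 0) + _] := @mean_mx_sum 1 1 _ (index_enum 'I_n) L bL.
rewrite mxE summxE => E; rewrite mxE.
transitivity (\int[mu]_x (\sum_k L k x) 0 0).
  apply: eq_Rintegral => x _; rewrite mxE summxE.
  by apply: eq_bigr => k _; rewrite mxE mulr1n.
rewrite E; apply: eq_bigr => k _; rewrite mxE.
by apply: eq_Rintegral => x _; rewrite mxE mulr1n.
Qed.

Lemma mean_mxMl {m n p} (C : 'M[R]_(p, m)) (H : X -> 'M[R]_(m, n)) :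
  bmeas_mx H -> mean_mx (fun x => C *m H x) = C *m mean_mx H.
Proof.
move=> bH; apply/matrixP => i j; rewrite mean_mxM //; last exact: bmeas_mx_cst.
rewrite mxE; apply: eq_bigr => k _.
by rewrite mxE RintegralZl // bmeas_mx_integrable.
Qed.

Lemma mean_mxMr {m n p} (C : 'M[R]_(n, p)) (H : X -> 'M[R]_(m, n)) :
  bmeas_mx H -> mean_mx (fun x => H x *m C) = mean_mx H *m C.
Proof.
move=> bH; apply: trmx_inj; rewrite -mean_mx_tr.
under eq_fun do rewrite trmx_mul.
by rewrite mean_mxMl ?trmx_mul ?mean_mx_tr //; exact: bmeas_mx_tr.
Qed.

Lemma mean_mx_ge {m n} (H K : X -> 'M[R]_(m, n)) i j :
  bmeas_mx H -> bmeas_mx K -> (forall x, H x i j <= K x i j) ->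
  mean_mx H i j <= mean_mx K i j.
Proof.
move=> bH bK HK; rewrite !mxE.
by apply: le_Rintegral => //; exact: bmeas_mx_integrable.
Qed.

Definition ip {m : nat} (f g : X -> 'cV[R]_m) : R :=
  (mean_mx (fun x => (f x)^T *m g x)) 0 0.

End BoundedMatrixFunctions.

(** * The sandwiched operator on bounded functions *)

(** Log-convexity makes the ratios [u n.+1 / u n] nondecreasing, and the first one exceeds [q]. The
    strict inequality at the start also forces all terms to be positive. *)
Lemma log_convex_growth (R : realFieldType) (u : nat -> R) (q : R) :
  0 < q -> (forall n, 0 <= u n) ->
  (forall n, u n.+1 ^+ 2 <= u n * u n.+2) -> q * u 0%N < u 1%N ->
  0 < u 0%N /\ forall n, q ^+ n * u 0%N <= u n.
Proof.
move=> q0 u0 uc u01.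
have u1 : 0 < u 1%N by rewrite (le_lt_trans _ u01) // mulr_ge0 // ltW.
have u00 : 0 < u 0%N.
  rewrite lt_neqAle u0 andbT eq_sym; apply/eqP => E.
  by have := uc 0%N; rewrite E mul0r leNgt exprn_gt0.
have step n : 0 < u n /\ q * u n <= u n.+1.
  elim: n => [|n [un qn]]; first by rewrite (ltW u01).
  have unS : 0 < u n.+1 by rewrite (lt_le_trans _ qn) // mulr_gt0.
  split => //; rewrite -(ler_pM2l un) (le_trans _ (uc n)) // expr2 mulrA.
  by rewrite ler_wpM2r // ?(ltW unS) // mulrC.
split => //; elim=> [|n IH]; first by rewrite expr0 mul1r.
by rewrite exprS -mulrA (le_trans _ (step n).2) // ler_wpM2l // ltW.
Qed.

Section InnerProduct.
Context {R : realType} {dX : measure_display} {X : measurableType dX}.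
Variables (mu : probability X R) (m : nat).
Implicit Types f g h : X -> 'cV[R]_m.

Lemma ipC f g : ip mu f g = ip mu g f.
Proof.
rewrite /ip -[in RHS](trmxK (mean_mx _ _)) -mean_mx_tr [RHS]mxE.
by under [in RHS]eq_fun do rewrite trmx_mul trmxK.
Qed.

Lemma ipDr f g h : bmeas_mx f -> bmeas_mx g -> bmeas_mx h ->
  ip mu f (fun x => g x + h x) = ip mu f g + ip mu f h.
Proof.
move=> bf bg bh; rewrite /ip; under eq_fun do rewrite mulmxDr.
by rewrite mean_mxD ?mxE //; apply: bmeas_mxM => //; exact: bmeas_mx_tr.
Qed.

Lemma ipZr c f g : bmeas_mx f -> bmeas_mx g ->
  ip mu f (fun x => c *: g x) = c * ip mu f g.
Proof.
move=> bf bg; rewrite /ip; under eq_fun do rewrite -scalemxAr.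
by rewrite mean_mxZ ?mxE //; apply: bmeas_mxM => //; exact: bmeas_mx_tr.
Qed.

Lemma ip_cst f (c : 'cV[R]_m) : bmeas_mx f ->
  ip mu f (fun=> c) = ((mean_mx mu f)^T *m c) 0 0.
Proof.
by move=> bf; rewrite /ip mean_mxMr ?mean_mx_tr //; exact: bmeas_mx_tr.
Qed.

Lemma ip_ge0 f : 0 <= ip mu f f.
Proof.
rewrite /ip mxE; apply: Rintegral_ge0 => x _.
by rewrite mxE sumr_ge0 // => i _; rewrite mxE -expr2 sqr_ge0.
Qed.

Lemma ip_sqD f g s t : bmeas_mx f -> bmeas_mx g ->
  ip mu (fun x => s *: f x + t *: g x) (fun x => s *: f x + t *: g x) =
  s ^+ 2 * ip mu f f + s * t * ip mu f g *+ 2 + t ^+ 2 * ip mu g g.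
Proof.
move=> bf bg; have bsf := bmeas_mxZ s bf; have btg := bmeas_mxZ t bg.
have bh := bmeas_mxD bsf btg.
rewrite ipDr // !ipZr // 2!(ipC (fun x => _ + _)) !ipDr // !ipZr //.
by rewrite (ipC g f); ring.
Qed.

Lemma ip_cauchy_schwarz f g : bmeas_mx f -> bmeas_mx g ->
  ip mu f g ^+ 2 <= ip mu f f * ip mu g g.
Proof.
move=> bf bg; have q s t : 0 <= s ^+ 2 * ip mu f f + s * t * ip mu f g *+ 2
    + t ^+ 2 * ip mu g g by rewrite -ip_sqD // ip_ge0.
have := ip_ge0 f; have := ip_ge0 g; move: q.
set A := ip mu f f; set B := ip mu f g; set C := ip mu g g => q C0 A0.
have [C1|C1] := ltP 0 C.
  (* The quadratic form is evaluated at [s = C], [t = - B]. *)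
  rewrite -subr_ge0 -(pmulr_rge0 _ C1).
  have -> // : C * (A * C - B ^+ 2) =
    C ^+ 2 * A + C * (- B) * B *+ 2 + (- B) ^+ 2 * C by ring.
have {C1}CE : C = 0 by apply/le_anti/andP.
have [->|B0] := eqVneq B 0; first by rewrite CE expr0n mulr0.
(* With [C = 0] the form is affine in [t]; this [t] would give it the value [-1]. *)
have := q 1 (- (A + 1) / (2 * B)); rewrite CE.
have -> : 1 ^+ 2 * A + 1 * (- (A + 1) / (2 * B)) * B *+ 2 +
    (- (A + 1) / (2 * B)) ^+ 2 * 0 = - 1 by field.
by rewrite ler0N1.
Qed.

End InnerProduct.

Section Sandwich.
Context {R : realType} {dX : measure_display} {X : measurableType dX}.
Variables (mu : probability X R) (m : nat) (B : X -> 'M[R]_m) (lam : R).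
Hypotheses (bB : bmeas_mx B) (Bs : forall x, (B x)^T = B x).
Implicit Types f g h : X -> 'cV[R]_m.

Definition sandwich f : X -> 'cV[R]_m := fun x =>
  B x *m (lam *: (B x *m f x) + (1 - lam) *: mean_mx mu (fun y => B y *m f y)).

Lemma bmeas_sandwich f : bmeas_mx f -> bmeas_mx (sandwich f).
Proof.
move=> bf; apply: bmeas_mxM => //; apply: bmeas_mxD.
  by apply: bmeas_mxZ; exact: bmeas_mxM.
exact: bmeas_mx_cst.
Qed.

Lemma bmeas_iter_sandwich n f : bmeas_mx f -> bmeas_mx (iter n sandwich f).
Proof. by move=> bf; elim: n => //= n; exact: bmeas_sandwich. Qed.

Lemma ip_sandwich f g : bmeas_mx f -> bmeas_mx g ->
  ip mu f (sandwich g) =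
  lam * ip mu (fun x => B x *m f x) (fun x => B x *m g x) +
  (1 - lam) * ((mean_mx mu (fun x => B x *m f x))^T *m
               mean_mx mu (fun x => B x *m g x)) 0 0.
Proof.
move=> bf bg; have bBf := bmeas_mxM bB bf; have bBg := bmeas_mxM bB bg.
rewrite -ip_cst // -!ipZr //; last exact: bmeas_mx_cst.
rewrite -ipDr //; first last.
- by apply: bmeas_mxZ; exact: bmeas_mx_cst.
- exact: bmeas_mxZ.
rewrite /ip; congr ((mean_mx _ _) _ _); apply/funext => x.
by rewrite trmx_mul Bs -!mulmxA.
Qed.

Lemma sandwich_selfadjoint f g : bmeas_mx f -> bmeas_mx g ->
  ip mu (sandwich f) g = ip mu f (sandwich g).
Proof.
move=> bf bg; rewrite ipC !ip_sandwich // ipC; congr (_ + _ * _).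
by rewrite -[in RHS](trmxK (mean_mx mu (fun x => B x *m g x))) -trmx_mul [RHS]mxE.
Qed.

Lemma ip_iter_sandwich p q f g : bmeas_mx f -> bmeas_mx g ->
  ip mu (iter p sandwich f) (iter q sandwich g) = ip mu f (iter (p + q) sandwich g).
Proof.
move=> bf bg; elim: p q => [//|p IH] q.
rewrite iterS sandwich_selfadjoint; try exact: bmeas_iter_sandwich.
by rewrite -iterS IH addSnnS.
Qed.

Lemma sandwichZ c f : bmeas_mx f ->
  sandwich (fun x => c *: f x) = (fun x => c *: sandwich f x).
Proof.
move=> bf; apply/funext => x; rewrite /sandwich.
under eq_fun do rewrite -scalemxAr.
rewrite mean_mxZ; last exact: bmeas_mxM.
by rewrite -scalemxAr !scalerA ![_ * c]mulrC -!scalerA -scalerDr -scalemxAr.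
Qed.

Lemma iter_sandwichZ n c f : bmeas_mx f ->
  iter n sandwich (fun x => c *: f x) = (fun x => c *: iter n sandwich f x).
Proof.
move=> bf; elim: n => //= n ->; rewrite sandwichZ //.
exact: bmeas_iter_sandwich.
Qed.

(* The moments [ip (A^n f) (A^n f)] of a self-adjoint [A] are log-convex, so a
   single step growing by [r] forces geometric growth. *)
Lemma sandwich_growth (a : nat -> R) (r : R) f : bmeas_mx f -> 0 < r ->
  (forall g h, bmeas_mx g -> bmeas_mx h ->
     exists2 C, 0 < C & forall n, `|ip mu g (iter n sandwich h)| <= C * a n) ->
  r ^+ 2 * ip mu f f < ip mu (sandwich f) (sandwich f) ->
  exists2 C, 0 < C & forall n, C * r ^+ n <= a n.
Proof.
move=> bf r0 dom gr.
pose u n := ip mu (iter n sandwich f) (iter n sandwich f).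
have bi n := bmeas_iter_sandwich n bf.
have uE n : u n = ip mu f (iter (n + n) sandwich f) := ip_iter_sandwich n n bf bf.
have u_ge0 n : 0 <= u n by exact: ip_ge0.
(* By self-adjointness [u n.+1 = <A^n f, A^(n+2) f>], to which Cauchy-Schwarz applies. *)
have uc n : u n.+1 ^+ 2 <= u n * u n.+2.
  have nE : (n + n.+2 = n.+1 + n.+1)%N by rewrite addnS addSn.
  have e : u n.+1 = ip mu (iter n sandwich f) (iter n.+2 sandwich f).
    by rewrite uE -nE (ip_iter_sandwich n n.+2 bf bf).
  by rewrite e; exact: ip_cauchy_schwarz (bi n) (bi n.+2).
have u01 : r ^+ 2 * u 0%N < u 1%N by exact: gr.
clearbody u; have [u0 ug] := log_convex_growth (exprn_gt0 2 r0) u_ge0 uc u01.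
have [C C0 Ca] := dom f f bf bf.
have [C' C'0 Ca'] := dom (sandwich f) f (bmeas_sandwich bf) bf.
(* [u k = <f, A^(2k) f>] reaches even exponents only. Odd ones are reached through
   [u k.+1 = <A f, A^(2k+1) f>], which explains the second pair in [dom] and the extra factor
   [r]. *)
exists (Num.min (u 0%N / C) (r * u 0%N / C')).
  by rewrite lt_min !divr_gt0 // mulr_gt0.
have even_case k : u 0%N / C * r ^+ k.*2 <= a k.*2.
  have := le_trans (ler_norm _) (Ca k.*2); rewrite -addnn -uE => H.
  have := le_trans (ug k) H; rewrite -exprM mul2n -addnn => H'.
  by rewrite mulrAC ler_pdivrMr // mulrC [leRHS]mulrC.
have odd_case k : r * u 0%N / C' * r ^+ k.*2.+1 <= a k.*2.+1.
  have e1 : u k.+1 = ip mu (sandwich f) (iter k.*2.+1 sandwich f).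
    rewrite uE (_ : (k.+1 + k.+1 = 1 + k.*2.+1)%N); last by rewrite addnn doubleS.
    exact: (esym (ip_iter_sandwich 1 k.*2.+1 bf bf)).
  have := le_trans (ler_norm _) (Ca' k.*2.+1); rewrite -e1 => H.
  have := le_trans (ug k.+1) H; rewrite -exprM mul2n doubleS => H'.
  by rewrite mulrAC ler_pdivrMr // [leRHS]mulrC mulrAC -exprS.
have min_le x y z : y * r ^+ x <= a x -> z <= y -> z * r ^+ x <= a x.
  by move=> ya zy; rewrite (le_trans _ ya) // (ler_wpM2r (exprn_ge0 _ (ltW r0))).
move=> n; rewrite -(odd_double_half n) addnC; case: (odd n); rewrite ?addn1 ?addn0.
- by apply: (min_le _ _ _ (odd_case n./2)); rewrite ge_min lexx orbT.
- by apply: (min_le _ _ _ (even_case n./2)); rewrite ge_min lexx.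
Qed.

End Sandwich.

(** * Positivity *)

Definition unvec {R : Type} {d : nat} (h : 'cV[R]_(d * d)) : 'M[R]_d :=
  \matrix_(i, j) h (mxtens_index (i, j)) ord0.

Definition vec {R : Type} {d : nat} (M : 'M[R]_d) : 'cV[R]_(d * d) :=
  \col_k M (mxtens_unindex k).1 (mxtens_unindex k).2.

Lemma sum_mxtens (R : zmodType) (m n : nat) (f : 'I_(m * n) -> R) :
  \sum_k f k = \sum_i \sum_j f (mxtens_index (i, j)).
Proof.
rewrite pair_bigA (reindex (@mxtens_index m n)); last first.
  by apply: onW_bij; exists (@mxtens_unindex m n);
    [exact: mxtens_indexK|exact: mxtens_unindexK].
by apply: eq_bigr => -[].
Qed.

Lemma vecK (R : Type) d : cancel (@vec R d) unvec.
Proof. by move=> M; apply/matrixP => i j; rewrite !mxE mxtens_indexK. Qed.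

Lemma unvec_tens (R : comNzRingType) d (G H : 'M[R]_d) (h : 'cV[R]_(d * d)) :
  unvec (tensmx G H *m h) = G *m unvec h *m H^T.
Proof.
apply/matrixP => i j; rewrite !mxE sum_mxtens exchange_big.
apply: eq_bigr => l _ /=; rewrite !mxE big_distrl; apply: eq_bigr => k _ /=.
by rewrite tensmxE !mxE mulrAC.
Qed.

Lemma unvecD (R : zmodType) d (h k : 'cV[R]_(d * d)) :
  unvec (h + k) = unvec h + unvec k.
Proof. by apply/matrixP => i j; rewrite !mxE. Qed.

Lemma unvecZ (R : pzRingType) d c (h : 'cV[R]_(d * d)) :
  unvec (c *: h) = c *: unvec h.
Proof. by apply/matrixP => i j; rewrite !mxE. Qed.

Lemma vec_dot (R : comNzRingType) d (h k : 'cV[R]_(d * d)) :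
  (h^T *m k) 0 0 = \tr ((unvec h)^T *m unvec k).
Proof.
rewrite mxE sum_mxtens exchange_big; apply: eq_bigr => j _ /=; rewrite mxE.
by apply: eq_bigr => i _; rewrite !mxE.
Qed.

Lemma vec_tens1 (R : comNzRingType) d (M : 'M[R]_d) :
  tensmx M M *m vec 1%:M = vec (M *m M^T).
Proof.
apply: (can_inj (f := unvec) (g := vec)).
  by move=> h; apply/colP => k; rewrite !mxE; congr (h _ _); exact: mxtens_unindexK.
by rewrite unvec_tens !vecK mulmx1.
Qed.

(* [dominated H S] says that the block matrix [[S, H], [H^T, S]] is positive
   semidefinite; unlike [- S <= H <= S] it makes sense for non-symmetric [H]. *)
Definition dominated {R : realType} {d : nat} (H S : 'M[R]_d) : Prop :=
  forall u v : 'cV[R]_d, 2 * (u^T *m H *m v) 0 0 <=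
    (u^T *m S *m u) 0 0 + (v^T *m S *m v) 0 0.

Section Dominated.
Context {R : realType} {d : nat}.
Implicit Types H S G : 'M[R]_d.

Lemma dominated_congr G H S : dominated H S ->
  dominated (G *m H *m G^T) (G *m S *m G^T).
Proof.
move=> HS u v; have := HS (G^T *m u) (G^T *m v).
by rewrite !trmx_mul !trmxK !mulmxA.
Qed.

Lemma dominatedD (s t : R) H S H' S' : 0 <= s -> 0 <= t ->
  dominated H S -> dominated H' S' ->
  dominated (s *: H + t *: H') (s *: S + t *: S').
Proof.
move=> s0 t0 HS HS' u v.
rewrite !mulmxDr !mulmxDl -!scalemxAr -!scalemxAl !mxE.
have := ler_wpM2l s0 (HS u v); have := ler_wpM2l t0 (HS' u v).
rewrite !mxE; lra.
Qed.

Lemma dominated_psd H S : dominated H S -> psdmx S.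
Proof.
(* The terms in [H] of the two tests cancel. *)
move=> HS v; have := HS v v; have := HS v (- v).
rewrite ?linearN /= ?mulNmx ?mulmxN ?opprK !mxE; lra.
Qed.

(** Testing on [e_i] and on plus or minus [e_j] gives [2 |H i j| <= S i i + S j j], and each
    diagonal entry is at most the trace. *)
Lemma dominated_entry H S i j : dominated H S ->
  `|H i j| <= \tr S.
Proof.
move=> HS.
have E (A : 'M[R]_d) k l :
    ((delta_mx k 0 : 'cV[R]_d)^T *m A *m (delta_mx l 0 : 'cV[R]_d)) 0 0 = A k l.
  by rewrite trmx_delta -rowE -colE !mxE.
have pS k : 0 <= S k k by have := dominated_psd HS (delta_mx k 0); rewrite E.
have tS k : S k k <= \tr S.
  by rewrite /mxtrace (bigD1 k) //= lerDl sumr_ge0.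
have h1 := HS (delta_mx i 0) (delta_mx j 0).
have h2 := HS (delta_mx i 0) (- delta_mx j 0).
rewrite !E in h1; move: h2.
rewrite ?linearN /= ?mulNmx ?mulmxN ?opprK mxE !E => h2.
have := tS i; have := tS j; rewrite ler_norml.
move=> *; apply/andP; split; lra.
Qed.

(** Summing [2 |u_i H_ij v_j| <= C (u_i^2 + v_j^2)] over [i] and [j] gives [C d (|u|^2 + |v|^2)];
    the lower bound on [S] costs the division by [c]. *)
Lemma dominated_of_bound (C c : R) H S : 0 < c -> 0 <= C ->
  (forall i j, `|H i j| <= C) -> (forall u : 'cV_d, c * (u^T *m u) 0 0 <= (u^T *m S *m u) 0 0) ->
  dominated H ((C * d%:R / c) *: S).
Proof.
move=> c0 C0 HC cS u v.
have qZ k (w : 'cV[R]_d) : (w^T *m (k *: S) *m w) 0 0 = k * (w^T *m S *m w) 0 0.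
  by rewrite -scalemxAr -scalemxAl mxE.
rewrite !qZ; set K := C * d%:R / c; have K0 : 0 <= K.
  by rewrite divr_ge0 ?mulr_ge0 // ltW.
apply: (@le_trans _ _ (C * d%:R * ((u^T *m u) 0 0 + (v^T *m v) 0 0))); last first.
  have -> : C * d%:R = K * c by rewrite divfK // gt_eqF.
  have := ler_wpM2l K0 (cS u); have := ler_wpM2l K0 (cS v); lra.
have -> : (u^T *m H *m v) 0 0 = \sum_j \sum_i u i 0 * H i j * v j 0.
  rewrite mxE; apply: eq_bigr => j _; rewrite mxE mulr_suml.
  by apply: eq_bigr => i _; rewrite mxE.
have -> : C * d%:R * ((u^T *m u) 0 0 + (v^T *m v) 0 0) =
    \sum_(j < d) \sum_(i < d) C * (u i 0 ^+ 2 + v j 0 ^+ 2).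
  have sq (w : 'cV[R]_d) : (w^T *m w) 0 0 = \sum_i w i 0 ^+ 2.
    by rewrite mxE; apply: eq_bigr => i _; rewrite mxE expr2.
  rewrite !sq; set Su := \sum_i u i 0 ^+ 2.
  transitivity (\sum_(j < d) C * (Su + d%:R * v j 0 ^+ 2)).
    rewrite -mulr_sumr big_split /= sumr_const card_ord -mulr_sumr.
    by rewrite -[Su *+ d]mulr_natl -mulrDr mulrA.
  apply: eq_bigr => j _; rewrite -mulr_sumr big_split /= sumr_const card_ord.
  by rewrite mulr_natl.
rewrite mulr_sumr; apply: ler_sum => j _; rewrite mulr_sumr.
apply: ler_sum => i _; have := HC i j; rewrite ler_norml => /andP[h1 h2].
(* [(C - h) (x + y)^2 + (C + h) (x - y)^2 = 2 C (x^2 + y^2) - 4 h x y]. *)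
set x := u i 0; set y := v j 0; set h := H i j in h1 h2 *.
have := mulr_ge0 (_ : 0 <= C - h) (sqr_ge0 (x + y)).
have := mulr_ge0 (_ : 0 <= C + h) (sqr_ge0 (x - y)).
move=> /(_ ltac:(lra)) p1 /(_ ltac:(lra)) p2; nra.
Qed.

End Dominated.

(** * Preservation of the positive semidefinite cone *)

Section SandwichDominated.
Context {R : realType} {dX : measure_display} {X : measurableType dX}.
Variables (mu : probability X R) (d : nat) (G : X -> 'M[R]_d) (lam c : R).
Hypotheses (bG : bmeas_mx G) (Gs : forall x, (G x)^T = G x).
Hypotheses (lam0 : 0 <= lam) (lam1 : lam <= 1) (c0 : 0 < c).
Hypothesis G_lower : forall x S, psdmx S -> c * \tr S <= \tr (G x *m G x *m S).

Let B x := tensmx (G x) (G x).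
Let g0 x : 'cV[R]_(d * d) := B x *m vec 1%:M.
Implicit Types f h s : X -> 'cV[R]_(d * d).

Lemma bmeas_tens : bmeas_mx B.
Proof.
split.
  move=> i j; rewrite /B; under eq_fun do rewrite mxE.
  exact: (measurable_funM (bG.1 _ _) (bG.1 _ _)).
have [C C0 GC] := bmeas_mx_bound bG.
by exists (C * C) => x i j; rewrite mxE normrM ler_pM.
Qed.

Lemma tens_sym x : (B x)^T = B x.
Proof. by rewrite trmx_tens Gs. Qed.

Lemma bmeas_unvec h : bmeas_mx h -> bmeas_mx (fun x => unvec (h x)).
Proof.
move=> [mh [C hC]]; split; first by move=> i j; under eq_fun do rewrite mxE; exact: mh.
by exists C => x i j; rewrite mxE.
Qed.

Lemma unvec_mean h : unvec (mean_mx mu h) = mean_mx mu (fun x => unvec (h x)).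
Proof.
apply/matrixP => i j; rewrite !mxE; apply: eq_Rintegral => x _; by rewrite mxE.
Qed.

Lemma unvec_B x h : unvec (B x *m h x) = G x *m unvec (h x) *m (G x)^T.
Proof. exact: unvec_tens. Qed.

Lemma dominated_mean (H S : X -> 'M[R]_d) : bmeas_mx H -> bmeas_mx S ->
  (forall x, dominated (H x) (S x)) -> dominated (mean_mx mu H) (mean_mx mu S).
Proof.
move=> bH bS HS u v.
have E (K : X -> 'M[R]_d) (w z : 'cV[R]_d) : bmeas_mx K ->
    w^T *m mean_mx mu K *m z = mean_mx mu (fun x => w^T *m K x *m z) /\
    bmeas_mx (fun x => w^T *m K x *m z).
  move=> bK; have bwK : bmeas_mx (fun x => w^T *m K x).
    by apply: bmeas_mxM => //; exact: bmeas_mx_cst.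
  split; first by rewrite mean_mxMr // mean_mxMl.
  by apply: bmeas_mxM => //; exact: bmeas_mx_cst.
have [EH bH'] := E H u v bH; have [Eu bu] := E S u u bS; have [Ev bv] := E S v v bS.
rewrite EH Eu Ev.
have := @mean_mx_ge _ _ _ mu _ _ (fun x => 2 *: (u^T *m H x *m v))
  (fun x => u^T *m S x *m u + v^T *m S x *m v) 0 0 (bmeas_mxZ 2 bH') (bmeas_mxD bu bv).
rewrite mean_mxD // mean_mxZ // !mxE; apply => x.
rewrite [leLHS]mxE [leRHS]mxE; exact: HS.
Qed.

Lemma dominated_sandwich f s : bmeas_mx f -> bmeas_mx s ->
  (forall x, dominated (unvec (f x)) (unvec (s x))) ->
  forall x, dominated (unvec (sandwich mu B lam f x)) (unvec (sandwich mu B lam s x)).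
Proof.
move=> bf bs fs x; rewrite /sandwich !unvec_tens; apply: dominated_congr.
rewrite !unvecD !unvecZ; apply: dominatedD => //; first by rewrite subr_ge0.
  by rewrite !unvec_B; exact: dominated_congr.
have bBf := bmeas_mxM bmeas_tens bf; have bBs := bmeas_mxM bmeas_tens bs.
rewrite !unvec_mean; apply: dominated_mean; try exact: bmeas_unvec.
by move=> y; rewrite !unvec_B; exact: dominated_congr.
Qed.

Lemma dominated_iter_sandwich n f s : bmeas_mx f -> bmeas_mx s ->
  (forall x, dominated (unvec (f x)) (unvec (s x))) ->
  forall x, dominated (unvec (iter n (sandwich mu B lam) f x))
                      (unvec (iter n (sandwich mu B lam) s x)).
Proof.
move=> bf bs fs; elim: n => //= n IH.
by apply: dominated_sandwich => //; apply: bmeas_iter_sandwich => //; exact: bmeas_tens.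
Qed.

Lemma bmeas_g0 : bmeas_mx g0.
Proof. by apply: bmeas_mxM; [exact: bmeas_tens|exact: bmeas_mx_cst]. Qed.

Lemma g0E x : g0 x = vec (G x *m G x).
Proof. by rewrite /g0 vec_tens1 Gs. Qed.

Lemma dominated_g0 f : bmeas_mx f ->
  exists2 C, 0 <= C & forall x, dominated (unvec (f x)) (unvec (C *: g0 x)).
Proof.
move=> bf; have [C C0 fC] := bmeas_mx_bound bf.
exists (C * d%:R / c); first by rewrite divr_ge0 ?mulr_ge0 // ltW.
move=> x; rewrite unvecZ; apply: dominated_of_bound => //.
  by move=> i j; rewrite mxE.
move=> u; rewrite g0E vecK.
have tr1 (M : 'M[R]_d) : \tr (M *m (u *m u^T)) = (u^T *m M *m u) 0 0.
  by rewrite mulmxA mxtrace_mulC mulmxA /mxtrace big_ord1.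
rewrite -tr1 (_ : (u^T *m u) 0 0 = \tr (u *m u^T)); last first.
  by rewrite mxtrace_mulC /mxtrace big_ord1.
(* The rank-one matrix [u u^T] is positive semidefinite: its form at [v] is [(v^T u)^2]. *)
apply: G_lower => v; rewrite !mulmxA -mulmxA mxE big_ord1.
rewrite (_ : (u^T *m v) 0 0 = (v^T *m u) 0 0) -?expr2 ?sqr_ge0 //.
by rewrite -[in RHS](trmxK u) -trmx_mul [RHS]mxE.
Qed.

(** The bound is pointwise before it is integrated. If [K g] dominates [h], then [K A^n g] dominates
    [A^n h], so each entry of [A^n h] is at most [K \tr (A^n g)], which [G_lower] bounds by [K / c]
    times [<g, A^n g>] at the same point. The factor [C (d d)] comes from pairing with [f]. *)
Lemma sandwich_dominated f h : bmeas_mx f -> bmeas_mx h ->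
  exists2 C, 0 < C & forall n,
    `|ip mu f (iter n (sandwich mu B lam) h)| <=
    C * ip mu g0 (iter n (sandwich mu B lam) g0).
Proof.
move=> bf bh; have [K K0 dom] := dominated_g0 bh.
have [C C0 fC] := bmeas_mx_bound bf.
pose D := C * K * (d * d)%:R / c.
have D0 : 0 <= D by rewrite divr_ge0 ?mulr_ge0 // ltW.
(* [D] may be zero, whereas the constant must be positive. *)
exists (D + 1); first by rewrite ltr_wpDl.
move=> n; set A := iter n _.
have bA s : bmeas_mx s -> bmeas_mx (A s).
  by move=> bs; apply: bmeas_iter_sandwich => //; exact: bmeas_tens.
have bI s t : bmeas_mx s -> bmeas_mx t -> bmeas_mx (fun x => (s x)^T *m t x).
  by move=> bs bt; apply: bmeas_mxM => //; exact: bmeas_mx_tr.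
(* Domination of [0] encodes positive semidefiniteness, so the iteration lemma for [dominated] also
   shows that [A^n g] stays in the cone. *)
have psdg x : dominated 0 (unvec (g0 x)).
  have psd w : 0 <= (w^T *m unvec (g0 x) *m w) 0 0.
    rewrite g0E vecK -{1}(Gs x) mulmxA -trmx_mul -mulmxA mxE.
    by apply: sumr_ge0 => i _; rewrite mxE -expr2 sqr_ge0.
  by move=> u v; rewrite mulmx0 mul0mx mxE mulr0 addr_ge0.
have psdA x : psdmx (unvec (A g0 x)).
  apply: (@dominated_psd _ _ (unvec (A (fun=> 0) x))).
  apply: dominated_iter_sandwich; [exact: bmeas_mx_cst|exact: bmeas_g0|move=> y].
  suff -> : unvec (0 : 'cV[R]_(d * d)) = 0 by [].
  by apply/matrixP => i j; rewrite !mxE.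
have tr_le x : \tr (unvec (A g0 x)) <= c^-1 * ((g0 x)^T *m A g0 x) 0 0.
  rewrite mulrC ler_pdivlMr // mulrC vec_dot.
  by rewrite g0E vecK trmx_mul Gs; exact: G_lower.
have ip0 x : 0 <= ((g0 x)^T *m A g0 x) 0 0.
  rewrite -(pmulr_rge0 _ (_ : 0 < c^-1)) ?invr_gt0 // (le_trans _ (tr_le x)) //.
  apply: sumr_ge0 => i _; have := psdA x (delta_mx i 0).
  by rewrite trmx_delta -rowE -colE !mxE.
have pt x : `|((f x)^T *m A h x) 0 0| <= D * ((g0 x)^T *m A g0 x) 0 0.
  have := dominated_iter_sandwich n bh (bmeas_mxZ K bmeas_g0) dom x.
  rewrite iter_sandwichZ //; [|exact: bmeas_tens|exact: bmeas_g0].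
  rewrite -/A unvecZ => domA.
  rewrite mxE (le_trans (ler_norm_sum _ _ _)) //.
  apply: (@le_trans _ _ (\sum_(k < d * d) C * \tr (K *: unvec (A g0 x)))).
    apply: ler_sum => k _; rewrite normrM mxE ler_pM //.
    have := dominated_entry (mxtens_unindex k).1 (mxtens_unindex k).2 domA.
    by rewrite mxE -surjective_pairing mxtens_unindexK.
  rewrite sumr_const card_ord -mulr_natr linearZ /= /D.
  set N := (d * d)%:R; have N0 : 0 <= N by [].
  have := ler_wpM2l (mulr_ge0 (mulr_ge0 C0 K0) N0) (tr_le x).
  set T := \tr _; set T' := (_ *m _) 0 0.
  by rewrite !mulrA (_ : C * K * N * T = C * K * T * N) //; ring.
have bA' : bmeas_mx (A g0) by apply: bA; exact: bmeas_g0.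
have ipI := bI _ _ _ bmeas_g0 bA'; have ipfI := bI _ _ _ bf (bA _ bh).
have ipA0 : 0 <= ip mu g0 (A g0).
  by rewrite /ip mxE; apply: Rintegral_ge0 => x _; exact: ip0.
apply: (@le_trans _ _ (D * ip mu g0 (A g0))); last by rewrite ler_wpM2r // lerDl.
have DE : D * ip mu g0 (A g0) =
    mean_mx mu (fun x => D *: ((g0 x)^T *m A g0 x)) 0 0.
  by rewrite mean_mxZ // mxE.
rewrite DE ler_norml; apply/andP; split.
  rewrite lerNl -mulN1r.
  have -> : - 1 * ip mu f (A h) = mean_mx mu (fun x => (-1) *: ((f x)^T *m A h x)) 0 0.
    by rewrite mean_mxZ // mxE.
  apply: mean_mx_ge; try exact: bmeas_mxZ.
  move=> x; rewrite [leLHS]mxE [leRHS]mxE mulN1r (le_trans _ (pt x)) //.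
  by rewrite -normrN ler_norm.
apply: mean_mx_ge => //; first exact: bmeas_mxZ.
by move=> x; rewrite [leRHS]mxE (le_trans (ler_norm _)).
Qed.

End SandwichDominated.

(** * The lazy chain *)

Lemma integral_mscale (R : realType) (d : measure_display) (T : measurableType d)
    (m : {measure set T -> \bar R}) (k : {nonneg R}) (f : T -> \bar R) :
  m.-integrable setT f ->
  (\int[mscale k m]_x f x = k%:num%:E * \int[m]_x f x)%E.
Proof.
move=> fi; have mf := measurable_int _ fi.
rewrite [LHS]integralE [X in (_ * X)%E]integralE muleBr //; last first.
  exact: (integrable_add_def measurableT fi).
rewrite !ge0_integral_mscale //.
- exact: measurable_funeneg.
- exact: measurable_funepos.
Qed.

Lemma bounded_integrable (R : realType) (d : measure_display) (T : measurableType d)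
    (m : {measure set T -> \bar R}) (f : T -> R) (C : R) :
  (m setT < +oo)%E -> measurable_fun setT f -> (forall x, `|f x| <= C) ->
  m.-integrable setT (EFin \o f).
Proof.
move=> moo mf fC; apply: measurable_bounded_integrable => //.
by exists C; split=> [|M CM x _]; [exact: num_real|exact: le_trans (fC _) (ltW CM)].
Qed.

Lemma probability_lty (R : realType) (d : measure_display) (T : measurableType d)
    (P : probability T R) : (P setT < +oo)%E.
Proof. exact: le_lt_trans (probability_le1 P measurableT) (ltry _). Qed.

Section MarkovStep.
Context {R : realType} {dX dO : measure_display} {X : measurableType dX}
  {Omega : measurableType dO}.
Variables (mu : probability X R) (lam : R) (Pr : probability Omega R).
Variable s : nat -> Omega -> X.
Hypothesis s_chain : markov_chain mu (lazy_kernel mu lam) Pr s.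
Hypotheses (lam0 : 0 <= lam) (lam1 : lam <= 1).

Definition past_system n : set (set Omega) :=
  \bigcup_(i in `I_n.+1) preimage_set_system setT (s i) measurable.

(** The sample space with the coarser sigma-algebra of the past; measurability on this type
    expresses dependence on [s_0, ..., s_n] alone. *)
Definition past_type n := g_sigma_algebraType (past_system n).

Lemma past_measurable n B : past s n B -> measurable B.
Proof.
apply: smallest_sub; first exact: sigma_algebra_measurable.
by move=> _ [i _ [A mA <-]]; apply: (chain_measurable s_chain).
Qed.

Lemma measurable_past_id n : measurable_fun setT (fun w : Omega => w : past_type n).
Proof. by move=> _ A mA; rewrite setTI; exact: (@past_measurable n A mA). Qed.

Lemma measurable_past_state n i : (i <= n)%N ->
  measurable_fun setT (s i : past_type n -> X).
Proof.
move=> ilen _ A mA; apply: sub_sigma_algebra.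
by exists i => //=; exists A.
Qed.

Lemma chain_step_set n A B : measurable A -> past s n B ->
  Pr (B `&` s n.+1 @^-1` A) =
  (lam%:E * Pr (B `&` s n @^-1` A) + (1 - lam)%:E * (Pr B * mu A))%E.
Proof.
move=> mA pB; have mB := past_measurable pB.
have msA : measurable (s n @^-1` A).
  by rewrite -[X in measurable X]setTI; exact: (chain_measurable s_chain).
rewrite (chain_step s_chain) // /lazy_kernel.
have mi : measurable_fun B (fun w => (\1_(s n @^-1` A) w)%:E : \bar R).
  by apply: measurable_funTS; apply/measurable_EFinP; exact: measurable_indic.
have -> : (fun w => lam%:E * \d_(s n w) A + (1 - lam)%:E * mu A)%E =
    (fun w => lam%:E * (\1_(s n @^-1` A) w)%:E + cst ((1 - lam)%:E * mu A) w)%E.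
  by apply/funext => w; rewrite diracE indicE.
rewrite ge0_integralD //; first last.
- by move=> w _; rewrite mule_ge0 // lee_fin subr_ge0.
- by apply: emeasurable_funM => //; exact: measurable_cst.
- by move=> w _; rewrite mule_ge0 // lee_fin.
rewrite ge0_integralZl_EFin // integral_indic // setIC; congr (_ + _)%E.
by rewrite integral_cst // muleA muleAC.
Qed.

(** The law of the past together with [s_(n+1)] equals [lam] times the law of the past together with
    [s_n], plus [1 - lam] times the product of [Pr] and [mu]. Both measures agree on rectangles by
    [chain_step_set], hence everywhere, as rectangles form a generating pi-system. Integrating
    [Y p.1 * phi p.2] against them gives the claim. *)
Lemma chain_step_integral n (Y : past_type n -> R) (phi : X -> R) (C D : R) :
  measurable_fun setT Y -> (forall w, `|Y w| <= C) ->
  measurable_fun setT phi -> (forall x, `|phi x| <= D) ->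
  \int[Pr]_w (Y w * phi (s n.+1 w)) =
  lam * \int[Pr]_w (Y w * phi (s n w)) +
  (1 - lam) * (\int[Pr]_w Y w * \int[mu]_x phi x).
Proof.
move=> mY YC mphi phiD.
pose Psi (p : past_type n * X) : R := Y p.1 * phi p.2.
have mPsi : measurable_fun setT Psi.
  by apply: measurable_funM; [exact: measurableT_comp mY measurable_fst
    |exact: measurableT_comp mphi measurable_snd].
have PsiB p : `|Psi p| <= C * D by rewrite normrM ler_pM.
have ms k := chain_measurable s_chain k.
have mJ k : measurable_fun setT (fun w : Omega => (w : past_type n, s k w)).
  by apply: measurable_fun_pair => //; exact: measurable_past_id.
(* The product measure lives on [Omega * X]; the identity map transports it to the coarser
   sigma-algebra of the past. *)
have mE : measurable_fun setT (fun p : Omega * X => (p.1 : past_type n, p.2)).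
  apply: measurable_fun_pair => //.
  exact: measurableT_comp (@measurable_past_id n) measurable_fst.
pose J k := measure_function_pushforward__canonical__measure_function_Measure Pr (mJ k).
pose I := measure_function_pushforward__canonical__measure_function_Measure
  (Pr \x mu)%E mE.
pose l0 : {nonneg R} := NngNum lam0.
have lam1' : 0 <= 1 - lam by rewrite subr_ge0.
pose l1 : {nonneg R} := NngNum lam1'.
pose J2 := measure_add (mscale l0 (J n)) (mscale l1 I).
have JE A : measurable A -> J n.+1 A = J2 A.
  apply: (measure_unique [set A `*` B | A in measurable & B in measurable] (fun=> setT)).
  - exact: measurable_prod_measurableType.
  - move=> _ _ [A1 mA1 [B1 mB1 <-]] [A2 mA2 [B2 mB2 <-]].
    by rewrite -setXI; exists (A1 `&` A2); [exact: measurableI|exists (B1 `&` B2);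
      [exact: measurableI|]].
  - by move=> _; exists setT => //; exists setT => //; rewrite setXTT.
  - by rewrite bigcup_const.
  - move=> _ [A1 mA1 [B1 mB1 <-]].
    transitivity (mscale l0 (J n) (A1 `*` B1) + mscale l1 I (A1 `*` B1))%E; last first.
      exact/esym/measure_addE.
    rewrite /mscale /J /I /= /pushforward.
    have -> k : (fun w : Omega => (w : past_type n, s k w)) @^-1` (A1 `*` B1) =
        A1 `&` s k @^-1` B1 by [].
    have -> : (fun p : Omega * X => (p.1 : past_type n, p.2)) @^-1` (A1 `*` B1) =
        (A1 : set Omega) `*` B1 by [].
    have pA1 : measurable (A1 : set Omega) := @past_measurable n A1 mA1.
    rewrite product_measure1E //.
    exact: (@chain_step_set n B1 A1 mB1 mA1).
  - by move=> k; rewrite /J /= /pushforward preimage_setT probability_setT ltry.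
have prodoo : ((Pr \x mu)%E setT < +oo)%E.
  rewrite -setXTT product_measure1E //.
  have -> : (Pr setT * mu setT = 1)%E by rewrite !probability_setT mule1.
  exact: ltry.
have iJ k : (J k).-integrable setT (EFin \o Psi).
  apply: (@bounded_integrable _ _ _ _ _ (C * D)) => //.
  by rewrite /J /= /pushforward preimage_setT probability_setT ltry.
have iI : I.-integrable setT (EFin \o Psi).
  apply: (@bounded_integrable _ _ _ _ _ (C * D)) => //.
have mPsiJ k : measurable_fun setT (fun w : Omega => Y w * phi (s k w) : R).
  exact: measurableT_comp mPsi (mJ k).
have EJ k : (\int[J k]_p (Psi p)%:E = (\int[Pr]_w (Y w * phi (s k w)))%:E)%E.
  rewrite (integral_pushforward (mJ k)) //; last 2 first.
  - exact/measurable_EFinP.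
  - exact: (bounded_integrable (probability_lty Pr) (mPsiJ k)
    (fun w => PsiB (w, s k w))).
  rewrite /Rintegral fineK //; apply: integrable_fin_num => //.
  exact: (bounded_integrable (probability_lty Pr) (mPsiJ k)
    (fun w => PsiB (w, s k w))).
have mYO : measurable_fun setT (Y : Omega -> R).
  exact: measurableT_comp mY (@measurable_past_id n).
have iY : Pr.-integrable setT (EFin \o (Y : Omega -> R)).
  exact: (bounded_integrable (probability_lty Pr) mYO YC).
have iphi : mu.-integrable setT (EFin \o phi).
  by apply: (bounded_integrable _ mphi phiD); exact: probability_lty.
have EI : (\int[I]_p (Psi p)%:E = (\int[Pr]_w Y w * \int[mu]_x phi x)%:E)%E.
  have iPsiE : (Pr \x mu)%E.-integrable setT ((EFin \o Psi) \o
      (fun p : Omega * X => (p.1 : past_type n, p.2))).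
    apply: (@bounded_integrable _ _ _ _ (fun p : Omega * X => Psi (p.1, p.2)) (C * D)) => //.
    exact: measurableT_comp mPsi mE.
  rewrite (integral_pushforward mE) //; last exact/measurable_EFinP.
  rewrite preimage_setT -(integral12_prod_meas1 iPsiE).
  transitivity (\int[Pr]_w ((\int[mu]_x phi x)%:E * (Y w)%:E))%E.
    apply: eq_integral => w _; rewrite /fubini_F /=.
    transitivity (\int[mu]_x ((Y w)%:E * (EFin \o phi) x))%E; first by [].
    rewrite integralZl // muleC; congr (_ * _)%E.
    by rewrite /Rintegral fineK // integrable_fin_num.
  rewrite -[LHS]/(\int[Pr]_w ((\int[mu]_x phi x)%:E * (EFin \o (Y : Omega -> R)) w))%E.
  rewrite integralZl // EFinM muleC; congr (_ * _)%E.
  by rewrite /Rintegral fineK // integrable_fin_num.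
apply: EFin_inj; apply: (etrans (esym (EJ n.+1))).
rewrite (eq_measure_integral J2); last by move=> A mA _; exact: JE.
have iS k0 (m : {measure set (past_type n * X) -> \bar R}) : (m setT < +oo)%E ->
    (mscale k0 m).-integrable setT (EFin \o Psi).
  move=> moo; apply: (@bounded_integrable _ _ _ _ _ (C * D)) => //.
  by rewrite /mscale lte_mul_pinfty.
have Jn : (J n setT < +oo)%E by exact: probability_lty.
rewrite (integral_measure_add measurableT (iS l0 (J n) Jn) (iS l1 I prodoo)).
rewrite !integral_mscale // EI; have -> := EJ n.
by rewrite -!EFinM -EFinD.
Qed.

End MarkovStep.

(** * Moments of matrix products along the chain *)

Section ChainMoments.
Context {R : realType} {dX dO : measure_display} {X : measurableType dX}
  {Omega : measurableType dO}.
Variables (mu : probability X R) (lam : R) (Pr : probability Omega R).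
Variable s : nat -> Omega -> X.
Hypothesis s_chain : markov_chain mu (lazy_kernel mu lam) Pr s.
Hypotheses (lam0 : 0 <= lam) (lam1 : lam <= 1).

Lemma bmeas_state m n k (H : X -> 'M[R]_(m, n)) : bmeas_mx H ->
  bmeas_mx (fun w : Omega => H (s k w)).
Proof.
move=> [mH [C HC]]; split; last by exists C.
by move=> i j; exact: measurableT_comp (mH i j) (chain_measurable s_chain k).
Qed.

Lemma bmeas_past_state m n k i (H : X -> 'M[R]_(m, n)) : (i <= k)%N -> bmeas_mx H ->
  bmeas_mx (fun w : past_type s k => H (s i w)).
Proof.
move=> ik [mH [C HC]]; split; last by exists C.
move=> a b; have ms := measurable_past_state (s := s) ik.
have mHs := measurableT_comp (mH a b) ms; exact: mHs.
Qed.

Lemma bmeas_past_forget m n k (H : past_type s k -> 'M[R]_(m, n)) : bmeas_mx H ->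
  @bmeas_mx R dO Omega m n H.
Proof.
move=> [mH [C HC]]; split; last by exists C.
move=> i j; exact: (measurableT_comp (mH i j) (measurable_past_id s_chain (n := k))).
Qed.

Lemma chain_initial_mean m n (H : X -> 'M[R]_(m, n)) : bmeas_mx H ->
  mean_mx Pr (fun w => H (s 0%N w)) = mean_mx mu H.
Proof.
move=> bH; apply/matrixP => i j; rewrite !mxE /Rintegral; congr fine.
have ms := chain_measurable s_chain 0%N.
pose J := measure_function_pushforward__canonical__measure_function_Measure Pr ms.
transitivity (\int[J]_x (H x i j)%:E)%E.
  rewrite (integral_pushforward ms) //.
  - by apply/measurable_EFinP; exact: bH.1.
  - exact: (bmeas_mx_integrable Pr i j (bmeas_state 0 bH)).
apply: eq_measure_integral => A mA _; exact: (chain_initial s_chain).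
Qed.

Lemma chain_step_mean m k (r : past_type s k -> 'rV[R]_m) (h : X -> 'cV[R]_m) :
  bmeas_mx r -> bmeas_mx h ->
  mean_mx Pr (fun w : Omega => r w *m h (s k.+1 w)) =
  mean_mx Pr (fun w : Omega => r w *m (lam *: h (s k w) + (1 - lam) *: mean_mx mu h)).
Proof.
move=> br bh; have brO := bmeas_past_forget br.
have bhs i := bmeas_state i bh.
under [in RHS]eq_fun do rewrite mulmxDr -!scalemxAr.
have b1 i : bmeas_mx (fun w : Omega => r w *m h (s i w)) by exact: bmeas_mxM.
rewrite mean_mxD; last 2 first.
- exact: bmeas_mxZ.
- by apply: bmeas_mxZ; apply: bmeas_mxM => //; exact: bmeas_mx_cst.
rewrite !mean_mxZ //; last by apply: bmeas_mxM => //; exact: bmeas_mx_cst.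
rewrite mean_mxMr //; apply/matrixP => a b; rewrite (ord1 a) (ord1 b).
have [C C0 rC] := bmeas_mx_bound br; have [D D0 hD] := bmeas_mx_bound bh.
have E i : mean_mx Pr (fun w : Omega => r w *m h (s i w)) 0 0 =
    \sum_j \int[Pr]_w (r w 0 j * h (s i w) j 0) by exact: mean_mxM.
rewrite [RHS]mxE [in RHS]mxE [X in _ + X]mxE !E mxE mulr_sumr mulr_sumr -big_split.
apply: eq_bigr => j _ /=; rewrite !mxE.
exact: (chain_step_integral s_chain lam0 lam1 (br.1 0 j) (fun w => rC w 0 j)
  (bh.1 j 0) (fun x => hD x j 0)).
Qed.

Section Moments.
Variables (m : nat) (B : X -> 'M[R]_m) (v : 'cV[R]_m).
Hypotheses (bB : bmeas_mx B).

(** Each factor is split as [B B], so that one copy of [B] stands on each side of the next averaging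
    step. *)
Definition chain_row k (w : Omega) : 'rV[R]_m :=
  v^T *m \prod_(j < k) (B (s j w) *m B (s j w)).

Lemma chain_rowS k w : chain_row k.+1 w = chain_row k w *m (B (s k w) *m B (s k w)).
Proof. by rewrite /chain_row big_ord_recr; exact: mulmxA. Qed.

(** The product defining [chain_row k] stops at [s_(k-1)], whence the range up to [n.+1]. *)
Lemma bmeas_chain_row k n : (k <= n.+1)%N ->
  bmeas_mx (chain_row k : past_type s n -> 'rV[R]_m).
Proof.
elim: k => [|k IH] kn.
  rewrite /chain_row; under eq_fun do rewrite big_ord0; exact: bmeas_mx_cst.
have -> : chain_row k.+1 = fun w => chain_row k w *m (B (s k w) *m B (s k w)).
  by apply/funext => w; rewrite chain_rowS.
have bBs := bmeas_past_state (kn : (k <= n)%N) bB.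
apply: (@bmeas_mxM R _ (past_type s n)); first exact: IH (ltnW kn).
exact: (@bmeas_mxM R _ (past_type s n)).
Qed.

(** The last state is integrated out repeatedly: conditioning on the past turns [B h] at [s_(k+1)]
    into its lazy average at [s_k], and a [B] released by [chain_row] completes [sandwich h]. Since
    [h] changes at each step, the induction is on [k] for all [h]. *)
Lemma chain_moment k (h : X -> 'cV[R]_m) : bmeas_mx h ->
  mean_mx Pr (fun w => chain_row k w *m (B (s k w) *m h (s k w))) =
  mean_mx mu (fun x => v^T *m (B x *m iter k (sandwich mu B lam) h x)).
Proof.
elim: k h => [|k IH] h bh.
  rewrite -chain_initial_mean; last first.
    by apply: bmeas_mxM; [exact: bmeas_mx_cst|exact: bmeas_mxM].
  congr (mean_mx _ _); apply/funext => w.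
  by rewrite /chain_row big_ord0 mulmx1.
rewrite iterSr -IH; last exact: bmeas_sandwich.
have bBh := bmeas_mxM bB bh.
have := chain_step_mean (@bmeas_chain_row k.+1 k (leqnn _)) bBh => ->.
congr (mean_mx _ _); apply/funext => w.
by rewrite chain_rowS /sandwich !mulmxA.
Qed.

End Moments.

(** For the product [N] of the factors, [|N|_F^2 = \tr (N N^T) = <vec I, (N (x) N) vec I>], and
    [N (x) N] is the product of the [B B]. The first and last [B] go into the two copies of [g0]. *)
Lemma expectation_frobenius d (G : X -> 'M[R]_d) n :
  bmeas_mx G -> (forall x, (G x)^T = G x) ->
  let B x := tensmx (G x) (G x) in
  let g0 x := B x *m vec 1%:M in
  ('E_Pr[fun w => (frobenius (\prod_(j < n.+1) (G (s j w) *m G (s j w))) ^+ 2)%R] =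
   (ip mu g0 (iter n (sandwich mu B lam) g0))%:E)%E.
Proof.
move=> bG Gs B g0.
have bB : bmeas_mx B by exact: bmeas_tens.
have bg : bmeas_mx g0 by apply: bmeas_mxM => //; exact: bmeas_mx_cst.
have Bs x : (B x)^T = B x by rewrite trmx_tens Gs.
pose N w := \prod_(j < n.+1) (G (s j w) *m G (s j w)).
pose r := chain_row B (vec 1%:M).
have NE k w : \prod_(j < k) (B (s j w) *m B (s j w)) =
    tensmx (\prod_(j < k) (G (s j w) *m G (s j w)))
           (\prod_(j < k) (G (s j w) *m G (s j w))).
  elim: k => [|k IH].
    rewrite !big_ord0; apply/matrixP => i j; rewrite !mxE -natrM mulnb.
    congr (_ %:R).
    by rewrite -xpair_eqE -!surjective_pairing (can_eq (@mxtens_unindexK _ _)).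
  rewrite !big_ord_recr IH /B /= !tensmx_mul; exact: tensmx_mul.
have frobE w : frobenius (N w) ^+ 2 =
    (r n w *m (B (s n w) *m g0 (s n w))) 0 0.
  have -> : r n w *m (B (s n w) *m g0 (s n w)) = r n.+1 w *m vec 1%:M.
    by rewrite /r chain_rowS /g0 !mulmxA.
  rewrite /r /chain_row NE -/(N w) -mulmxA vec_tens1 vec_dot !vecK trmx1 mul1mx.
  rewrite sqr_sqrtr; last by do 2![apply: sumr_ge0 => ? _]; exact: sqr_ge0.
  apply: eq_bigr => i _; rewrite mxE; apply: eq_bigr => j _.
  by rewrite mxE -normrX ger0_norm ?sqr_ge0.
have bgm : bmeas_mx (fun x => B x *m g0 x) by exact: bmeas_mxM.
have bR : bmeas_mx (fun w : Omega => r n w *m (B (s n w) *m g0 (s n w))).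
  apply: bmeas_mxM; last exact: (bmeas_state n bgm).
  exact: bmeas_past_forget (bmeas_chain_row (vec 1%:M) bB (leqnSn n)).
transitivity (mean_mx Pr (fun w : Omega => r n w *m (B (s n w) *m g0 (s n w))) 0 0)%:E.
  rewrite unlock mxE /Rintegral fineK; last first.
    apply: integrable_fin_num => //; exact: (bmeas_mx_integrable Pr 0 0 bR).
  by apply: eq_integral => w _; rewrite frobE.
rewrite chain_moment // /ip; congr ((mean_mx _ _) _ _)%:E; apply/funext => x.
by rewrite /g0 trmx_mul Bs mulmxA.
Qed.

End ChainMoments.

(** * The operator norm on the complex Hilbert space *)

Section ComplexVectors.
Context {R : realType} {m : nat}.
Implicit Types (z w : 'cV[R[i]]_m) (u : 'cV[R]_m).

Definition revec z : 'cV[R]_m := \col_i complex.Re (z i 0).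
Definition imvec z : 'cV[R]_m := \col_i complex.Im (z i 0).
Definition sqn (u : 'cV[R]_m) : R := (u^T *m u) 0 0.

Lemma sqn_ge0 u : 0 <= sqn u.
Proof. by rewrite /sqn mxE sumr_ge0 // => i _; rewrite mxE -expr2 sqr_ge0. Qed.

Lemma sqn_entry u i : u i 0 ^+ 2 <= sqn u.
Proof.
rewrite /sqn mxE (bigD1 i) //= mxE -expr2 lerDl.
by apply: sumr_ge0 => j _; rewrite mxE -expr2 sqr_ge0.
Qed.

Lemma cnorm_sqr z : cnorm z ^+ 2 = sqn (revec z) + sqn (imvec z).
Proof.
have -> : cnorm z = Num.sqrt (sqn (revec z) + sqn (imvec z)).
  rewrite /cnorm /dotc Re_sum /sqn !mxE -big_split; congr Num.sqrt.
  by apply: eq_bigr => i _; rewrite !mxE mulrC; exact: Re_mulJ.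
by rewrite sqr_sqrtr // addr_ge0 ?sqn_ge0.
Qed.

Lemma revec_mul (M : 'M[R]_m) z : revec (map_mx (real_complex R) M *m z) = M *m revec z.
Proof.
apply/colP => i; rewrite !mxE Re_sum; apply: eq_bigr => j _.
by rewrite !mxE Re_scale.
Qed.

Lemma imvec_mul (M : 'M[R]_m) z : imvec (map_mx (real_complex R) M *m z) = M *m imvec z.
Proof.
apply/colP => i; rewrite !mxE Im_sum; apply: eq_bigr => j _.
by rewrite !mxE Im_scale.
Qed.

Lemma revecZD (a b : R) z w :
  revec (real_complex R a *: z + real_complex R b *: w) = a *: revec z + b *: revec w.
Proof.
apply/colP => i; rewrite !mxE -!Re_scale.
by move: (real_complex R a * _) (real_complex R b * _) => [? ?] [? ?].
Qed.

Lemma imvecZD (a b : R) z w :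
  imvec (real_complex R a *: z + real_complex R b *: w) = a *: imvec z + b *: imvec w.
Proof.
apply/colP => i; rewrite !mxE -!Im_scale.
by move: (real_complex R a * _) (real_complex R b * _) => [? ?] [? ?].
Qed.

End ComplexVectors.

Section L2Norm.
Context {R : realType} {dX : measure_display} {X : measurableType dX}.
Variables (mu : probability X R) (m : nat).
Implicit Type h : X -> 'cV[R[i]]_m.

Lemma L2norm_sqr h :
  (L2norm mu h `^ 2 = \int[mu]_x (sqn (revec (h x)) + sqn (imvec (h x)))%:E)%E.
Proof.
rewrite /L2norm poweR_Lnorm //; apply: eq_integral => x _ /=.
by rewrite ger0_norm ?sqrtr_ge0 // powR_mulrn ?sqrtr_ge0 // cnorm_sqr.
Qed.

Lemma L2norm_le h (r : R) : 0 <= r ->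
  (L2norm mu h <= r%:E)%E =
  (\int[mu]_x (sqn (revec (h x)) + sqn (imvec (h x)))%:E <= (r ^+ 2)%:E)%E.
Proof.
move=> r0; rewrite -L2norm_sqr.
have rE : ((r ^+ 2)%:E = r%:E `^ 2)%E by rewrite poweR_EFin powR_mulrn.
rewrite rE; have in0y (x : \bar R) : (0 <= x)%E -> x \in `[0%E, +oo%E].
  by move=> x0; rewrite in_itv /= x0 leey.
have N0 : (0 <= L2norm mu h)%E by exact: Lnorm_ge0.
apply/idP/idP => [|/(gt0_ler_poweR (r := 2^-1))].
  by apply: gt0_ler_poweR => //; apply: in0y.
rewrite -!poweRrM mulfV // !poweRe1 //; apply; rewrite ?invr_ge0 //.
- by apply: in0y; exact: poweR_ge0.
- by apply: in0y; exact: poweR_ge0.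
Qed.

End L2Norm.

Section ComplexSandwich.
Context {R : realType} {dX : measure_display} {X : measurableType dX}.
Variables (mu : probability X R) (m : nat) (B : X -> 'M[R]_m) (lam : R).
Hypotheses (bB : bmeas_mx B) (Bs : forall x, (B x)^T = B x).

Definition mulop (h : X -> 'cV[R[i]]_m) : X -> 'cV[R[i]]_m :=
  fun x => map_mx (real_complex R) (B x) *m h x.

(** [B] and [lam] are real, so the complex operator commutes with taking real parts. *)
Lemma revec_csandwich h x :
  revec ((mulop \o P_hat mu lam \o mulop) h x) =
  sandwich mu B lam (fun y => revec (h y)) x.
Proof.
rewrite /= /mulop revec_mul /P_hat revecZD revec_mul /sandwich; congr (_ *m (_ + _ *: _)).
apply/colP => i; rewrite !mxE; apply: eq_Rintegral => y _.
by rewrite -revec_mul [RHS]mxE.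
Qed.

Lemma imvec_csandwich h x :
  imvec ((mulop \o P_hat mu lam \o mulop) h x) =
  sandwich mu B lam (fun y => imvec (h y)) x.
Proof.
rewrite /= /mulop imvec_mul /P_hat imvecZD imvec_mul /sandwich; congr (_ *m (_ + _ *: _)).
apply/colP => i; rewrite !mxE; apply: eq_Rintegral => y _.
by rewrite -imvec_mul [RHS]mxE.
Qed.

Lemma ip_sqn f : bmeas_mx f -> (\int[mu]_x (sqn (f x : 'cV[R]_m))%:E = (ip mu f f)%:E)%E.
Proof.
move=> bf; rewrite /ip mxE /Rintegral fineK //.
apply: integrable_fin_num => //.
by apply: (bmeas_mx_integrable mu 0 0); apply: bmeas_mxM => //; exact: bmeas_mx_tr.
Qed.

Lemma L2opnorm_step (N : R) f : bmeas_mx f -> 0 <= N ->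
  L2opnorm mu (mulop \o P_hat mu lam \o mulop) = N%:E ->
  ip mu (sandwich mu B lam f) (sandwich mu B lam f) <= N ^+ 2 * ip mu f f.
Proof.
move=> bf N0 NE; have bA g : bmeas_mx g -> bmeas_mx (sandwich mu B lam g).
  exact: bmeas_sandwich.
(* A null [f] cannot be normalised; there [<A f, A f> = <f, A (A f)>] vanishes by Cauchy-Schwarz.
   Any other [f] is scaled to norm one and tested as a complex function with zero imaginary part. *)
have := ip_ge0 mu f; rewrite le_eqVlt => /predU1P[f0|f0].
  rewrite -f0 mulr0 sandwich_selfadjoint //; last exact: bA.
  have := ip_cauchy_schwarz mu bf (bA _ (bA _ bf)).
  rewrite -f0 mul0r => H.
  have /eqP : ip mu f (sandwich mu B lam (sandwich mu B lam f)) ^+ 2 = 0.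
    by apply/le_anti; rewrite H sqr_ge0.
  by rewrite sqrf_eq0 => /eqP ->.
pose c := Num.sqrt (ip mu f f); have c0 : 0 < c by rewrite sqrtr_gt0.
have cE : c ^+ 2 = ip mu f f by rewrite sqr_sqrtr // ltW.
pose h x := map_mx (real_complex R) (c^-1 *: f x).
have reh x : revec (h x) = c^-1 *: f x by apply/colP => i; rewrite !mxE.
have imh x : imvec (h x) = 0 by apply/colP => i; rewrite !mxE.
have sqn0 : sqn (0 : 'cV[R]_m) = 0 by rewrite /sqn mulmx0 mxE.
have bcf : bmeas_mx (fun x => c^-1 *: f x) by exact: bmeas_mxZ.
have ipZ g : bmeas_mx g -> ip mu (fun x => c^-1 *: g x) (fun x => c^-1 *: g x) =
    ip mu g g / c ^+ 2.
  move=> bg; rewrite ipZr //; last exact: bmeas_mxZ.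
  by rewrite ipC ipZr // expr2 invfM; ring.
have h1 : (L2norm mu h <= 1%:E)%E.
  rewrite L2norm_le // (eq_integral (fun x => (sqn (c^-1 *: f x))%:E)); last first.
    by move=> x _; rewrite reh imh sqn0 addr0.
  by rewrite ip_sqn // ipZ // -cE divff ?expr1n // expf_neq0 // gt_eqF.
have hL2 : inL2 mu h.
  split; last by rewrite (le_lt_trans h1) // ltry.
  move=> i; split; under eq_fun do rewrite !mxE /=; last exact: measurable_cst.
  by have := bcf.1 i 0; under eq_fun do rewrite mxE.
have : (L2norm mu ((mulop \o P_hat mu lam \o mulop) h) <= N%:E)%E.
  by rewrite -NE; apply: ereal_sup_ubound; exists h.
rewrite L2norm_le // (eq_integral (fun x => (sqn (c^-1 *: sandwich mu B lam f x))%:E)); last first.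
  move=> x _; rewrite revec_csandwich imvec_csandwich.
  rewrite (_ : (fun y => revec (h y)) = (fun x => c^-1 *: f x)); last exact/funext.
  (* Zero is written as [0 *: f] so that [sandwichZ] shows its image to be zero. *)
  rewrite (_ : (fun y => imvec (h y)) = (fun x => 0 *: f x)); last first.
    by apply/funext => y; rewrite imh scale0r.
  by rewrite !sandwichZ // scale0r sqn0 addr0.
rewrite ip_sqn; last by apply: bmeas_mxZ; exact: bA.
rewrite ipZ; last exact: bA.
by rewrite lee_fin ler_pdivrMr ?exprn_gt0 // cE.
Qed.

End ComplexSandwich.

(** * From bounded to square-integrable functions *)

Section Truncation.
Context {R : realType} {dX : measure_display} {X : measurableType dX}.
Variables (mu : probability X R) (m : nat) (B : X -> 'M[R]_m) (lam : R).
Hypotheses (bB : bmeas_mx B) (Bs : forall x, (B x)^T = B x).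
Variables (q : X -> R) (q_meas : measurable_fun setT q).
Hypothesis q_int : mu.-integrable setT (EFin \o q).

(** The cut-off follows an integrable envelope [q], later [|h|^2], which serves both the real and
    the imaginary part. *)
Definition trunc (f : X -> 'cV[R]_m) (K : nat) : X -> 'cV[R]_m :=
  fun x => \1_(q @^-1` `]-oo, K%:R]) x *: f x.

Lemma trunc_eventually f x : \forall K \near \oo, trunc f K x = f x.
Proof.
exists (Num.truncn (Num.max (q x) 0)).+1 => // K /= hK.
rewrite /trunc indicE mem_set ?scale1r //= in_itv /=.
have q0 : 0 <= Num.max (q x) 0 by rewrite le_max lexx orbT.
apply: (@le_trans _ _ (Num.max (q x) 0)); first by rewrite le_max lexx.
have /andP[_ h] := truncn_itv q0.
by apply: ltW; apply: lt_le_trans h _; rewrite ler_nat.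
Qed.

Lemma bmeas_trunc f K : measurable_mx f -> (forall x i, f x i 0 ^+ 2 <= q x) ->
  bmeas_mx (trunc f K).
Proof.
move=> mf fq; split.
  move=> i j; rewrite (ord1 j) /trunc; under eq_fun do rewrite mxE.
  apply: measurable_funM => //; apply: measurable_indic.
  by rewrite -[X in measurable X]setTI; exact: q_meas.
(* [|y| <= 1 + y^2], and [y^2 <= q <= K] on the set that is kept. *)
exists (1 + K%:R) => x i j; rewrite (ord1 j) mxE indicE normrM.
have [qK|qK] := pselect ((q @^-1` `]-oo, K%:R]) x); last first.
  by rewrite memNset // normr0 mul0r addr_ge0.
rewrite mem_set // normr1 mul1r; move: qK => /=; rewrite in_itv /= => qK.
have := le_trans (fq x i) qK; rewrite -real_normK ?num_real //.
have := sqr_ge0 (`|f x i 0| - 1); nra.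
Qed.

Lemma trunc_mean_cvg f i : measurable_mx f -> (forall x i, f x i 0 ^+ 2 <= q x) ->
  mean_mx mu (fun y => B y *m trunc f K y) i 0 @[K --> \oo] -->
  mean_mx mu (fun y => B y *m f y) i 0.
Proof.
move=> mf fq; have [M M0 BM] := bmeas_mx_bound bB.
have q0 x (j : 'I_m) : 0 <= q x by rewrite (le_trans _ (fq x j)) // sqr_ge0.
(* The dominating function: [m] terms, entries of [B] at most [M], and
   [|f_j| <= 1 + f_j^2 <= 1 + q]. *)
pose G y : R := m%:R * M * (1 + q y).
have mBf : measurable_fun setT (fun y => (B y *m f y) i 0).
  under eq_fun do rewrite mxE; apply: measurable_sum => j.
  exact: (measurable_funM (bB.1 i j) (mf j 0)).
have iG : mu.-integrable setT (EFin \o G).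
  rewrite (_ : EFin \o G = fun y => ((m%:R * M)%:E * (1 + (q y)%:E))%E); last first.
    by apply/funext => y; rewrite /G /= EFinM EFinD.
  apply: integrableZl => //; apply: integrableD => //.
  exact: finite_measure_integrable_cst.
have dom K y : (`|((B y *m trunc f K y) i 0)%:E| <= (G y)%:E)%E.
  rewrite lee_fin mxE (le_trans (ler_norm_sum _ _ _)) //.
  rewrite /G -mulrA mulr_natl -[in leRHS](card_ord m) -sumr_const.
  apply: ler_sum => j _; rewrite normrM ler_pM // mxE normrM.
  apply: (@le_trans _ _ (1 * `|f y j 0|)).
    by rewrite ler_wpM2r // indicE; case: (_ \in _); rewrite ?normr1 ?normr0.
  have := fq y j; rewrite mul1r -real_normK ?num_real //.
  have := sqr_ge0 (`|f y j 0| - 1); nra.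
have [iBf _ cv] := @dominated_convergence _ X R mu setT measurableT
  (fun K y => ((B y *m trunc f K y) i 0)%:E) (fun y => ((B y *m f y) i 0)%:E)
  (EFin \o G)
  (fun K => iffRL (measurable_EFinP _ _) ((bmeas_mxM bB (bmeas_trunc K mf fq)).1 i 0))
  (iffRL (measurable_EFinP _ _) mBf)
  (aeW _ (fun y _ => cvg_near_cst _ (filterS (fun K E => congr1 (fun u => ((B y *m u) i 0)%:E) E)
    (trunc_eventually f y)))) iG (aeW _ (fun y K _ => dom K y)).
have fE : (\int[mu]_y ((B y *m f y) i 0)%:E = (\int[mu]_y (B y *m f y) i 0)%:E)%E.
  by rewrite /Rintegral fineK // integrable_fin_num.
rewrite fE in cv; rewrite [X in _ --> X]mxE; apply: cvg_trans (fine_cvg cv).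
by apply: near_eq_cvg; apply: nearW => K /=; rewrite mxE.
Qed.

End Truncation.

Section TruncationSandwich.
Context {R : realType} {dX : measure_display} {X : measurableType dX}.
Variables (mu : probability X R) (m : nat) (B : X -> 'M[R]_m) (lam : R).
Hypotheses (bB : bmeas_mx B) (Bs : forall x, (B x)^T = B x).

Lemma trunc_sandwich_cvg (q : X -> R) f x : measurable_fun setT q ->
  mu.-integrable setT (EFin \o q) -> measurable_mx f ->
  (forall x i, f x i 0 ^+ 2 <= q x) ->
  sqn (sandwich mu B lam (trunc q f K) x) @[K --> \oo] -->
  sqn (sandwich mu B lam f x).
Proof.
move=> mq iq mf fq.
have c1 i : sandwich mu B lam (trunc q f K) x i 0 @[K --> \oo] -->
    sandwich mu B lam f x i 0.
  rewrite /sandwich mxE; under eq_fun do rewrite mxE.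
  apply: (@cvg_sum_seq _ R^o) => j; apply: cvgMl_tmp.
  rewrite mxE [X in _ --> X + _]mxE [X in _ --> _ + X]mxE.
  under eq_fun do rewrite mxE [X in X + _]mxE [X in _ + X]mxE.
  apply: cvgD; apply: cvgMl_tmp; last exact: trunc_mean_cvg.
  apply: cvg_near_cst; apply: filterS (trunc_eventually q f x) => K E.
  by rewrite E.
rewrite /sqn mxE; under eq_fun do rewrite mxE.
apply: (@cvg_sum_seq _ R^o) => j; rewrite mxE; under eq_fun do rewrite mxE.
exact: cvgM.
Qed.

(** Truncation does not increase norms, so [step] bounds the images of the truncations uniformly.
    They converge pointwise, and Fatou's lemma passes the bound to the limit; a density argument
    would presuppose that the operator is continuous. *)
Lemma L2opnorm_le (r : R) : 0 <= r ->
  (forall f, bmeas_mx f ->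
     ip mu (sandwich mu B lam f) (sandwich mu B lam f) <= r ^+ 2 * ip mu f f) ->
  (L2opnorm mu (mulop B \o P_hat mu lam \o mulop B) <= r%:E)%E.
Proof.
move=> r0 step; apply: ge_ereal_sup => _ [h [[mh _] h1] <-].
rewrite L2norm_le //; rewrite L2norm_le // expr1n in h1.
pose f x := revec (h x); pose g x := imvec (h x).
pose q x := sqn (f x) + sqn (g x).
have mf : measurable_mx f.
  by move=> i j; rewrite (ord1 j) /f; under eq_fun do rewrite mxE; exact: (mh i).1.
have mg : measurable_mx g.
  by move=> i j; rewrite (ord1 j) /g; under eq_fun do rewrite mxE; exact: (mh i).2.
have msqn (k : X -> 'cV[R]_m) : measurable_mx k -> measurable_fun setT (fun x => sqn (k x)).
  move=> mk; rewrite /sqn; under eq_fun do rewrite mxE.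
  apply: measurable_sum => i; under eq_fun do rewrite mxE.
  exact: (measurable_funM (mk i 0) (mk i 0)).
have mq : measurable_fun setT q by apply: measurable_funD; exact: msqn.
have q0 x : 0 <= q x by rewrite addr_ge0 ?sqn_ge0.
have fq x i : f x i 0 ^+ 2 <= q x.
  by rewrite (le_trans (sqn_entry _ _)) // lerDl sqn_ge0.
have gq x i : g x i 0 ^+ 2 <= q x.
  by rewrite (le_trans (sqn_entry _ _)) // lerDr sqn_ge0.
have iq : mu.-integrable setT (EFin \o q).
  apply/integrableP; split; first exact/measurable_EFinP.
  under eq_integral do rewrite /= ger0_norm //.
  exact: le_lt_trans h1 (ltry _).
have bt K := bmeas_trunc mq K mf fq; have bu K := bmeas_trunc mq K mg gq.
have bA k : bmeas_mx k -> bmeas_mx (sandwich mu B lam k) by exact: bmeas_sandwich.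
pose u K x := (sqn (sandwich mu B lam (trunc q f K) x) +
               sqn (sandwich mu B lam (trunc q g K) x))%:E.
have mu_ K : measurable_fun setT (u K).
  apply/measurable_EFinP; apply: measurable_funD; apply: msqn.
    exact: (bA _ (bt K)).1.
  exact: (bA _ (bu K)).1.
have u0 K x : (0 <= u K x)%E by rewrite lee_fin addr_ge0 ?sqn_ge0.
have uint K : (\int[mu]_x u K x <= (r ^+ 2)%:E)%E.
  have splitI (k l : X -> 'cV[R]_m) : bmeas_mx k -> bmeas_mx l ->
      (\int[mu]_x (sqn (k x) + sqn (l x))%:E = (ip mu k k + ip mu l l)%:E)%E.
    move=> bk bl; under eq_integral do rewrite EFinD.
    rewrite ge0_integralD //.
    - by rewrite !ip_sqn.
    - by move=> x _; rewrite lee_fin sqn_ge0.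
    - by apply/measurable_EFinP; apply: msqn; exact: bk.1.
    - by move=> x _; rewrite lee_fin sqn_ge0.
    - by apply/measurable_EFinP; apply: msqn; exact: bl.1.
  rewrite splitI; [|exact: bA|exact: bA].
  apply: (@le_trans _ _ (r ^+ 2 * (ip mu (trunc q f K) (trunc q f K) +
                                   ip mu (trunc q g K) (trunc q g K)))%:E).
    by rewrite lee_fin mulrDr lerD // step.
  rewrite -[leRHS]mule1 EFinM lee_wpmul2l ?lee_fin ?sqr_ge0 //.
  rewrite -lee_fin; apply: le_trans h1; rewrite -splitI //; apply: ge0_le_integral => //.
  - by move=> x _; rewrite lee_fin addr_ge0 ?sqn_ge0.
  - by apply/measurable_EFinP; apply: measurable_funD; apply: msqn;
      [exact: (bt K).1|exact: (bu K).1].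
  - exact/measurable_EFinP.
  have tr_le (k : X -> 'cV[R]_m) x : sqn (trunc q k K x) <= sqn (k x).
    rewrite /trunc indicE; case: (_ \in _); rewrite ?scale1r ?scale0r //.
    by rewrite {1}/sqn mulmx0 mxE sqn_ge0.
  by move=> x _; rewrite lee_fin; apply: lerD; exact: tr_le.
apply: le_trans (_ : (limn_einf (fun K => \int[mu]_x u K x) <= _)%E); last first.
  rewrite limn_einf_lim; apply: lime_le; first exact: is_cvg_einfs.
  apply: nearW => K; apply: le_trans (uint K); apply: ereal_inf_lbound.
  by exists K => /=.
apply: le_trans (fatou mu measurableT mu_ (fun K x _ => u0 K x)).
rewrite le_eqVlt; apply/orP; left; apply/eqP; apply: eq_integral => x _.
have cu : u K x @[K --> \oo] --> (sqn (sandwich mu B lam f x) + sqn (sandwich mu B lam g x))%:E.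
  apply: cvg_EFin; first by apply: nearW.
  by apply: cvgD; apply: trunc_sandwich_cvg.
rewrite revec_csandwich imvec_csandwich.
by rewrite is_cvg_limn_einfE; [apply/esym/cvg_lim|apply/cvg_ex; eexists; exact: cu].
Qed.

End TruncationSandwich.

(** * Growth rates *)

Section GrowthRate.
Variables (R : realType) (a : nat -> R) (N : \bar R).
Hypothesis lower : forall r, 0 < r -> (r%:E < N)%E ->
  exists2 C, 0 < C & forall n, C * r ^+ n <= a n.

Let small (c e : R) : 0 < e -> \forall n \near \oo, `|n%:R^-1 * c| <= e.
Proof.
move=> e0; exists (Num.truncn (`|c| / e)).+1 => // n /= hn.
have ce0 : 0 <= `|c| / e by rewrite divr_ge0 // ltW.
have /andP[_ h] := truncn_itv ce0.
have n0 : (0 : R) < n%:R by rewrite ltr0n (leq_trans _ hn).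
rewrite normrM ger0_norm ?invr_ge0 ?ler0n // mulrC ler_pdivrMr // mulrC -ler_pdivrMr //.
by rewrite (le_trans (ltW h)) // ler_nat.
Qed.

Lemma growth_rate_ge (r e : R) : 0 < r -> (r%:E < N)%E -> 0 < e ->
  \forall n \near \oo, 0 < a n.-1 /\ ln r - e <= n%:R^-1 * ln (a n.-1).
Proof.
move=> r0 rN e0; have [C C0 Ca] := lower r0 rN.
have ap n : 0 < a n by rewrite (lt_le_trans _ (Ca n)) // mulr_gt0 // exprn_gt0.
have h1 := small (ln C - ln r) e0; have h2 := nbhs_infty_gt 0.
near=> n; split => //.
have n0 : (0 < n)%N by near: n.
have hs : `|n%:R^-1 * (ln C - ln r)| <= e by near: n.
have nE : n%:R = n.-1%:R + 1 :> R by rewrite natr1 prednK.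
have nR : (0 : R) < n%:R by rewrite ltr0n.
apply: (@le_trans _ _ (n%:R^-1 * (ln C + n.-1%:R * ln r))); last first.
  rewrite ler_wpM2l ?invr_ge0 ?ler0n //.
  rewrite mulr_natl -lnXn // -lnM ?posrE ?exprn_gt0 //.
  by rewrite ler_ln ?posrE // mulr_gt0 // exprn_gt0.
(* The constant and the shift from [n] to [n.-1] cost only [(ln C - ln r) / n]. *)
have -> : n%:R^-1 * (ln C + n.-1%:R * ln r) = ln r + n%:R^-1 * (ln C - ln r).
  have -> : n.-1%:R = n%:R - 1 :> R by rewrite nE addrK.
  by field; rewrite gt_eqF.
by rewrite lerD2l; move: hs; rewrite ler_norml => /andP[].
Unshelve. all: by end_near. Qed.

(** The index [n.-1] reflects that the [n]-th moment involves one factor more than its power of the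
    operator. The norm is an extended real, so [N = +oo] is a case here rather than a finiteness
    proof elsewhere. *)
Lemma growth_rate_cvg : (forall n, 0 <= a n) -> (0 <= N)%E ->
  (forall r, 0 <= r -> N = r%:E -> exists2 C, 0 <= C & forall n, a n <= C * r ^+ n) ->
  ((n%:R^-1)%:E * lne (a n.-1)%:E)%E @[n --> \oo] --> lne N.
Proof.
move=> a0 N0 upper.
have [NE|Noo] := eqVneq N +oo%E.
  rewrite NE -[lne +oo]/(+oo%E : \bar R); apply/cvgeyPge => A.
  have r0 : 0 < expR (A + 1) :> R by exact: expR_gt0.
  have rN : ((expR (A + 1))%:E < N)%E by rewrite NE ltry.
  apply: filterS (growth_rate_ge r0 rN ltr01) => n [an].
  by rewrite expRK addrK lne_EFin // -EFinM lee_fin.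
have [r rE] : exists r, N = r%:E.
  by exists (fine N); rewrite fineK // ge0_fin_numE // lt_neqAle Noo leey.
have r0 : 0 <= r by rewrite -lee_fin -rE.
have [C C0 aC] := upper r r0 rE.
move: r0; rewrite le_eqVlt => /predU1P[r0|r0].
  (* If [N = 0], the upper bound [C * 0 ^+ n] kills every term but the first, and both sides are
     [lne 0 = -oo]. *)
  rewrite rE -r0 (le0_lneNy (lexx _)); apply: cvg_near_cst.
  near=> n; have n1 : (1 < n)%N by near: n; exact: nbhs_infty_gt.
  have -> : a n.-1 = 0.
    apply/le_anti; rewrite a0 andbT (le_trans (aC _)) // -r0 expr0n.
    have /negbTE -> : n.-1 != 0%N by rewrite -lt0n -subn1 subn_gt0.
    by rewrite mulr0.
  by rewrite (le0_lneNy (lexx _)) gt0_muleNy // lte_fin invr_gt0 ltr0n ltnW.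
rewrite rE lne_EFin //.
(* Any positive rate below [N] makes the sequence eventually positive, hence its logarithm
   finite. *)
have half : ((r / 2)%:E < N)%E by rewrite rE lte_fin; lra.
have ap : \forall n \near \oo, 0 < a n.-1.
  have h : 0 < r / 2 by lra.
  by apply: filterS (growth_rate_ge h half ltr01) => n [].
apply: cvg_EFin; first by apply: filterS ap => n an; rewrite lne_EFin.
apply/cvgrPdist_le => e e0.
have e2 : 0 < e / 2 by lra.
(* Half of [e] pays for a rate strictly below [N], the other half for the multiplicative
   constant. *)
have r'0 : 0 < r * expR (- (e / 2)) by rewrite mulr_gt0 // expR_gt0.
have r'N : ((r * expR (- (e / 2)))%:E < N)%E.
  by rewrite rE lte_fin gtr_pMr // -[ltRHS]expR0 ltr_expR; lra.
have lo := growth_rate_ge r'0 r'N e2.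
have sm := small (ln C - ln r) e2; have h2 := nbhs_infty_gt 0.
near=> n; have an : 0 < a n.-1 by near: n.
have n0 : (0 < n)%N by near: n.
have fE : fine ((n%:R^-1)%:E * lne (a n.-1)%:E)%E = n%:R^-1 * ln (a n.-1).
  by rewrite lne_EFin.
rewrite -[X in _ - X]/(fine ((n%:R^-1)%:E * lne (a n.-1)%:E)%E) fE.
rewrite distrC ler_norml; apply/andP; split.
  have [_] : 0 < a n.-1 /\ ln (r * expR (- (e / 2))) - e / 2 <= n%:R^-1 * ln (a n.-1).
    by near: n.
  rewrite lnM ?posrE ?expR_gt0 // expRK; lra.
have hs : `|n%:R^-1 * (ln C - ln r)| <= e / 2 by near: n.
have Cp : 0 < C.
  rewrite -(pmulr_lgt0 _ (exprn_gt0 n.-1 r0)); exact: lt_le_trans an (aC _).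
have nE : n%:R = n.-1%:R + 1 :> R by rewrite natr1 prednK.
have nR : (0 : R) < n%:R by rewrite ltr0n.
have : n%:R^-1 * ln (a n.-1) <= n%:R^-1 * (ln C + n.-1%:R * ln r).
  rewrite ler_wpM2l ?invr_ge0 ?ler0n //.
  rewrite mulr_natl -lnXn // -lnM ?posrE ?exprn_gt0 //.
  by rewrite ler_ln ?posrE // mulr_gt0 // exprn_gt0.
have -> : n%:R^-1 * (ln C + n.-1%:R * ln r) = ln r + n%:R^-1 * (ln C - ln r).
  have -> : n.-1%:R = n%:R - 1 :> R by rewrite nE addrK.
  by field; rewrite gt_eqF.
move: hs; rewrite ler_norml => /andP[_ hs]; lra.
Unshelve. all: by end_near. Qed.

End GrowthRate.

Lemma L2opnorm_ge0 (R : realType) (dX : measure_display) (X : measurableType dX)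
    (mu : probability X R) (m : nat)
    (A : (X -> 'cV[R[i]]_m) -> (X -> 'cV[R[i]]_m)) :
  (0 <= L2opnorm mu A)%E.
Proof.
pose z (_ : X) : 'cV[R[i]]_m := 0.
have n0 : (L2norm mu z <= 0%:E)%E.
  rewrite L2norm_le // expr0n (eq_integral (fun=> 0%E)) => [|x _]; first by rewrite integral0.
  rewrite /z.
  have -> : revec (0 : 'cV[R[i]]_m) = 0 by apply/colP => i; rewrite !mxE.
  have -> : imvec (0 : 'cV[R[i]]_m) = 0 by apply/colP => i; rewrite !mxE.
  by rewrite /sqn mulmx0 mxE addr0.
apply: (@le_trans _ _ (L2norm mu (A z))); first exact: Lnorm_ge0.
apply: ereal_sup_ubound; exists z => //; split.
  split; last exact: le_lt_trans n0 (ltry _).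
  by move=> i; rewrite /z; split; under eq_fun do rewrite mxE; exact: measurable_cst.
exact: le_trans n0 lee01.
Qed.

(** By Cauchy-Schwarz and iteration of [L2opnorm_step], [<f, A^n f> <= |f| |A^n f| <= r^n |f|^2].
    The comparison is made between squares, so a negative left-hand side is treated apart. *)
Lemma sandwich_moment_le (R : realType) (dX : measure_display) (X : measurableType dX)
    (mu : probability X R) (m : nat) (B : X -> 'M[R]_m) (lam r : R)
    (f : X -> 'cV[R]_m) : bmeas_mx B -> (forall x, (B x)^T = B x) -> 0 <= r ->
  L2opnorm mu (mulop B \o P_hat mu lam \o mulop B) = r%:E -> bmeas_mx f ->
  forall n, ip mu f (iter n (sandwich mu B lam) f) <= ip mu f f * r ^+ n.
Proof.
move=> bB Bs r0 NE bf n; have bi k := bmeas_iter_sandwich mu lam bB k bf.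
have norm_le k : ip mu (iter k (sandwich mu B lam) f) (iter k (sandwich mu B lam) f)
    <= (r ^+ k) ^+ 2 * ip mu f f.
  elim: k => [|k IH]; first by rewrite expr0 expr1n mul1r.
  rewrite iterS; apply: le_trans (L2opnorm_step bB Bs (bi k) r0 NE) _.
  by rewrite [r ^+ k.+1]exprS exprMn -[leRHS]mulrA ler_wpM2l ?exprn_ge0.
have ff := ip_ge0 mu f; have rn : 0 <= r ^+ n by exact: exprn_ge0.
have [neg|pos] := ltP (ip mu f (iter n (sandwich mu B lam) f)) 0.
  by rewrite (le_trans (ltW neg)) // mulr_ge0.
rewrite -(ler_pXn2r (_ : (0 < 2)%N)) ?nnegrE ?mulr_ge0 //.
apply: le_trans (ip_cauchy_schwarz mu bf (bi n)) _.
by rewrite exprMn expr2 -mulrA ler_wpM2l // mulrC norm_le.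
Qed.

Theorem lemma5p4 (R : realType) (d : nat) (d_gt0 : (0 < d)%N)
    (dX : measure_display) (X : measurableType dX) (mu : probability X R)
    (lambda theta a b : R)
    (lambda_ge0 : 0 <= lambda) (lambda_lt1 : lambda < 1) (theta_gt0 : 0 < theta)
    (F : X -> 'M[R]_d) (F_meas : measurable_mx F)
    (F_sym : forall x, (F x)^T = F x)
    (F_bnd : forall x, loewner_le a%:M (F x) /\ loewner_le (F x) b%:M)
    (dO : measure_display) (Omega : measurableType dO)
    (Pr : probability Omega R) (s : nat -> Omega -> X)
    (s_chain : markov_chain mu (lazy_kernel mu lambda) Pr s) :
  let ET := expmul (kron_half F) (theta / 2) in
  ((n%:R^-1)%:E *
     lne 'E_Pr[fun w =>
       (frobenius (\prod_(j < n) expmx ((theta / 2) *: F (s j w))) ^+ 2)%R])%E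
    @[n --> \oo] -->
  lne (L2opnorm mu (ET \o P_hat mu lambda \o ET)).
Proof.
move=> ET; have lambda_le1 := ltW lambda_lt1.
(* [G] is the exponential at [theta/4]: its Kronecker square is the multiplier of [ET], and its
   matrix square is one factor of the chain product. *)
pose t := theta / 2 / 2; have t0 : 0 <= t by rewrite /t; lra.
have tt : t + t = theta / 2 by rewrite /t; lra.
pose G x := expmx (t *: F x).
have Gs x : (G x)^T = G x by have [aF Fb] := F_bnd x; exact: expmx_sym (F_sym x) aF Fb t.
have bG : bmeas_mx G.
  split; first exact: measurable_expmx F_meas F_sym F_bnd.
  exists (d%:R * expR (t * b)) => x i j; have [aF Fb] := F_bnd x.
  exact: (expmx_bound (F_sym x) aF Fb i j t0 : `|G x i j| <= _).
have GG x : G x *m G x = expmx ((theta / 2) *: F x).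
  by have [aF Fb] := F_bnd x; rewrite /G (expmx_double (F_sym x) aF Fb) tt.
pose c := expR (theta / 2 * a); have c0 : 0 < c by exact: expR_gt0.
have G_lower x (S : 'M[R]_d) : psdmx S -> c * \tr S <= \tr (G x *m G x *m S).
  move=> pS; have [aF Fb] := F_bnd x; rewrite GG.
  by apply: (expmx_trace_ge (F_sym x) aF Fb _ pS); lra.
pose B x := tensmx (G x) (G x).
have bB : bmeas_mx B by exact: bmeas_tens.
have Bs x : (B x)^T = B x by exact: tens_sym.
have -> : ET = mulop B.
  apply/funext => h; apply/funext => x; have [aF Fb] := F_bnd x.
  by rewrite /ET /expmul /kron_half (expmx_kron (F_sym x) aF Fb).
pose g x := B x *m (vec 1%:M : 'cV[R]_(d * d)).
have bg : bmeas_mx g by apply: bmeas_mxM => //; exact: bmeas_mx_cst.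
pose m n := ip mu g (iter n (sandwich mu B lambda) g).
have mE n : ('E_Pr[fun w =>
    (frobenius (\prod_(j < n.+1) expmx ((theta / 2) *: F (s j w))) ^+ 2)%R] = (m n)%:E)%E.
  rewrite -(expectation_frobenius s_chain lambda_ge0 lambda_le1 n bG Gs).
  congr expectation; apply/funext => w; congr (frobenius _ ^+ 2).
  by apply: eq_bigr => j _; rewrite GG.
have m0 n : 0 <= m n.
  by rewrite -lee_fin -mE unlock; apply: integral_ge0 => w _; rewrite lee_fin sqr_ge0.
apply: cvg_trans (growth_rate_cvg (a := m) _ m0 (L2opnorm_ge0 _ _) _).
(* For [n >= 1] the [n] factors are those of the moment [m n.-1]; only [n = 0] is discarded. *)
- apply: near_eq_cvg; exists 1%N => // n /= n1.
  by case: n n1 => // n _; rewrite mE.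
(* If no constant works for [r], then by [sandwich_growth] no bounded [f] has [|A f| > r |f|], and
   [L2opnorm_le] makes the norm at most [r]. *)
- move=> r r0 rN; apply: contrapT => nex; move: rN; apply/negP; rewrite -leNgt.
  apply: L2opnorm_le => //; first exact: ltW.
  move=> f bf; rewrite leNgt; apply/negP => gr; apply: nex.
  apply: (sandwich_growth bB Bs bf r0 _ gr) => f' h bf' bh.
  exact: (sandwich_dominated mu bG Gs lambda_ge0 lambda_le1 c0 G_lower bf' bh).
- move=> r r0 rN; exists (ip mu g g); first exact: ip_ge0.
  exact: sandwich_moment_le.
Qed.
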